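(* There exist universal constants $c_1,c_2>0$ and $\beta>1$, and for every $\gamma>1$ a constant $c_\gamma>0$ depending only on $\gamma$, such that for all positive integers $n$ and $p\ge 2$ with $c_1n^{\beta}\le p\le\exp(c_2n)$, $$\inf_{\breve\Theta=\breve\Theta(X)}\ \sup_{\substack{\Theta^*\in\mathcal{M}^{p\times p}\text{ nonsingular}\\ \gamma(\Sigma^* )\le\gamma}}\ \mathbb{E}\,L^{\mathrm{ssym}}(\breve\Theta,\Theta^* )\ \ge\ c_\gamma\sqrt{\frac{\log p}{n}},$$ where $\Sigma^*=(\Theta^* )^{-1}$, the expectation is over a random matrix $X\in\mathbb{R}^{n\times p}$ with i.i.d. $\mathcal{N}(0,\Sigma^* )$ rows, and the infimum is over all estimators, i.e. all measurable functions $\breve\Theta$ of $X$ with values in the $p\times p$ symmetric positive definite matrices.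
   Context: $\mathcal{M}^{p\times p}$ is the set of $p\times p$ symmetric positive semidefinite matrices $\Theta$ with $\Theta_{jk}\le 0$ for all $j\neq k$. The symmetrized Stein loss between symmetric positive definite $p\times p$ matrices $\Theta,\Theta^*$ with inverses $\Sigma=\Theta^{-1}$, $\Sigma^*=(\Theta^* )^{-1}$ is $$L^{\mathrm{ssym}}(\Theta,\Theta^* )=\frac{1}{2p}\langle\Theta-\Theta^*,\Sigma^*-\Sigma\rangle,\qquad \langle A,B\rangle=\mathrm{tr}(A^{\mathsf T}B).$$ For a positive definite $\Sigma^*$, $$\gamma(\Sigma^* )=\left(1-\max_{j\ne k}\frac{\Sigma^*_{jk}}{\sqrt{\Sigma^*_{jj}\Sigma^*_{kk}}}\right)^{-1}.$$ *)

(* Defs.v *)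
From HB Require Import structures.
From mathcomp Require Import all_boot all_order all_algebra.
From mathcomp Require Import all_classical all_reals all_analysis.
From mathcomp Require Import measurable_realfun ring.

Set Implicit Arguments.
Unset Strict Implicit.
Unset Printing Implicit Defensive.

Import Order.TTheory GRing.Theory Num.Theory.
Import numFieldNormedType.Exports.

Local Open Scope classical_set_scope.
Local Open Scope ring_scope.

(* The Borel sigma-algebra of R^(m x n), generated by the entries. *)
Definition mx_entry_sets (R : realType) m n : set (set 'M[R]_(m, n)) :=
  [set B | exists i j (A : set (measurableTypeR R)),
     measurable A /\ B = [set M : 'M[R]_(m, n) | A (M i j)]].

Section measurable_matrix.
Context {R : realType} {m n : nat}.

Let mx_set0 : <<s @mx_entry_sets R m n >> set0.
Proof. exact: sigma_algebra0. Qed.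

Let mx_setC A :
  <<s @mx_entry_sets R m n >> A -> <<s @mx_entry_sets R m n >> (~` A).
Proof. exact: sigma_algebraC. Qed.

Let mx_bigcup (F : (set 'M[R]_(m, n))^nat) :
  (forall i, <<s @mx_entry_sets R m n >> (F i)) ->
  <<s @mx_entry_sets R m n >> (\bigcup_i F i).
Proof. exact: sigma_algebra_bigcup. Qed.

HB.instance Definition _ := @isMeasurable.Build default_measure_display
  'M[R]_(m, n) <<s @mx_entry_sets R m n >> mx_set0 mx_setC mx_bigcup.

Lemma measurable_entry (i : 'I_m) (j : 'I_n) :
  measurable_fun [set: 'M[R]_(m, n)] (fun M => M i j).
Proof.
move=> _ A mA; rewrite setTI; apply: sub_sigma_algebra.
by exists i, j, A.
Qed.

Lemma measurable_fun_mxP d (T : measurableType d) (f : T -> 'M[R]_(m, n)) :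
  measurable_fun [set: T] f <->
  forall i j, measurable_fun [set: T] (fun x => f x i j).
Proof.
split=> [mf i j|mf].
  exact: (measurableT_comp (measurable_entry i j) mf).
apply: (@measurability _ _ _ _ _ _ (@mx_entry_sets R m n)) => //.
move=> _ [_ [i [j [A [mA ->]]]] <-].
exact: mf.
Qed.

End measurable_matrix.

Section lebesgue_rV.
Context {R : realType}.

Definition row_cons p (xv : measurableTypeR R * 'rV[R]_p) : 'rV[R]_(1 + p) :=
  row_mx (xv.1%:M : 'M[R]_1) xv.2.

Definition row_split p (w : 'rV[R]_(1 + p)) : measurableTypeR R * 'rV[R]_p :=
  (w 0 (lshift p 0), rsubmx w).

Lemma row_consK p : cancel (@row_cons p) (@row_split p).
Proof.
move=> [x v]; rewrite /row_cons /row_split /=; congr pair.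
  by rewrite row_mxEl mxE eqxx mulr1n.
by rewrite row_mxKr.
Qed.

Lemma measurable_row_cons p : measurable_fun setT (@row_cons p).
Proof.
apply/measurable_fun_mxP => i j; rewrite /row_cons.
case: (split_ordP j) => k ->.
  apply: (eq_measurable_fun fst) => [x _|]; last exact: measurable_fst.
  by rewrite row_mxEl !ord1 mxE eqxx mulr1n.
apply: (eq_measurable_fun (fun xv : measurableTypeR R * 'rV[R]_p => xv.2 i k)).
  by move=> x _; rewrite row_mxEr.
exact: (measurableT_comp (measurable_entry i k) measurable_snd).
Qed.

Lemma measurable_row_split p : measurable_fun setT (@row_split p).
Proof.
apply: measurable_fun_pair; first exact: measurable_entry.
apply/measurable_fun_mxP => i j.
apply: (eq_measurable_fun (fun M : 'rV[R]_(1 + p) => M i (rshift 1 j))).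
  by move=> x _; rewrite mxE.
exact: measurable_entry.
Qed.

HB.instance Definition _ p := isMeasurableFun.Build _ _ _ _ (@row_cons p)
  (@measurable_row_cons p).

Section step.
Variables (p : nat) (mu : {sigma_finite_measure set 'rV[R]_p -> \bar R}).

Definition lebesgue_cons : set 'rV[R]_(1 + p) -> \bar R :=
  pushforward ((@lebesgue_measure R) \x mu)%E (@row_cons p).

Let lebesgue_cons0 : lebesgue_cons set0 = 0%E.
Proof. exact: measure0. Qed.

Let lebesgue_cons_ge0 A : (0 <= lebesgue_cons A)%E.
Proof. exact: measure_ge0. Qed.

Let lebesgue_cons_sigma_additive : semi_sigma_additive lebesgue_cons.
Proof. exact: measure_semi_sigma_additive. Qed.

HB.instance Definition _ := isMeasure.Build _ _ _ lebesgue_cons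
  lebesgue_cons0 lebesgue_cons_ge0 lebesgue_cons_sigma_additive.

Let lebesgue_cons_sigma_finite : sigma_finite setT lebesgue_cons.
Proof.
have /sigma_finiteP[F [TF ndF Foo]] := sigma_finiteT (@lebesgue_measure R).
have /sigma_finiteP[G [TG ndG Goo]] := sigma_finiteT mu.
have FT : setT = \bigcup_k (F k `*` G k).
  rewrite -setXTT TF TG predeqE => -[x y]; split.
    move=> [/= [i _ Fix] [k _ Gky]]; exists (maxn i k) => //; split.
    - by move: x Fix; exact/subsetPset/ndF/leq_maxl.
    - by move: y Gky; exact/subsetPset/ndG/leq_maxr.
  by move=> [i _ []/= ? ?]; split; exists i.
exists (fun k => @row_split p @^-1` (F k `*` G k)).
  by rewrite -preimage_bigcup -FT preimage_setT.
move=> k; have [? ?] := Foo k; have [? ?] := Goo k; split.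
  rewrite -[X in measurable X]setTI; apply: measurable_row_split => //.
  exact: measurableX.
rewrite /lebesgue_cons /pushforward -comp_preimage.
rewrite (_ : _ \o _ = id); last by apply/funext => x; exact: row_consK.
by rewrite preimage_id product_measure1E// lte_mul_pinfty// ge0_fin_numE.
Qed.

HB.instance Definition _ := Measure_isSigmaFinite.Build _ _ _ lebesgue_cons
  lebesgue_cons_sigma_finite.

End step.

(* Lebesgue measure on R^p, as the iterated product of Lebesgue measure on R. *)
Fixpoint lebesgue_rV p : {sigma_finite_measure set 'rV[R]_p -> \bar R} :=
  if p is q.+1 then lebesgue_cons (lebesgue_rV q)
  else (\d_(0 : 'rV[R]_0) : {measure set _ -> \bar R}).

Lemma lebesgue_rVE p (A : 'I_p -> set (measurableTypeR R)) :
  (forall j, measurable (A j)) ->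
  lebesgue_rV p [set x | forall j, A j (x 0 j)] =
  (\prod_j lebesgue_measure (A j))%E.
Proof.
elim: p A => [|p IH] A mA.
  rewrite big_ord0 /= diracE (_ : _ \in _ = true)//.
  by apply/mem_set => -[].
rewrite big_ord_recl -IH//.
rewrite -product_measure1E//; last first.
  rewrite [X in measurable X](_ : _ = \bigcap_(j in setT)
     ((fun x : 'rV[R]_p => x 0 j) @^-1` A (lift ord0 j))); last first.
    by apply/seteqP; split=> [x xA j _|x xA j]; exact: xA.
  apply: fin_bigcap_measurable; first exact: finite_finset.
  by move=> j _; rewrite -[X in measurable X]setTI; apply: measurable_entry => //; exact: mA.
have e0 : lshift p 0 = ord0 :> 'I_(1 + p) by exact/val_inj.
have eS k : rshift 1 k = lift ord0 k :> 'I_(1 + p) by exact/val_inj.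
have cons0 x v : row_cons (x, v) 0 (ord0 : 'I_(1 + p)) = x.
  by rewrite -e0 row_mxEl mxE eqxx mulr1n.
have consS x v k : row_cons (x, v) 0 (lift ord0 k : 'I_(1 + p)) = v 0 k.
  by rewrite -eS row_mxEr.
rewrite /= /lebesgue_cons /pushforward; congr (_ _).
apply/seteqP; split=> [[x v] /= xvA|[x v] /= [xA vA] j].
  split=> [|j]; first by have := xvA ord0; rewrite cons0.
  by have := xvA (lift ord0 j); rewrite consS.
by case: (unliftP ord0 j) => [k|] ->; rewrite ?cons0 ?consS.
Qed.

End lebesgue_rV.

Section definiteness.
Context {R : realType}.

Definition quad_form p (A : 'M[R]_p) (x : 'rV[R]_p) : R :=
  (x *m A *m x^T) 0 0.

Definition psdmx p (A : 'M[R]_p) : Prop :=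
  A^T = A /\ forall x : 'rV[R]_p, 0 <= quad_form A x.

Definition posdefmx p (A : 'M[R]_p) : Prop :=
  A^T = A /\ forall x : 'rV[R]_p, x != 0 -> 0 < quad_form A x.

Lemma posdefmx1 p : posdefmx (1%:M : 'M[R]_p).
Proof.
split=> [|x x0]; first by rewrite trmx1.
rewrite /quad_form mulmx1 mxE.
have [j xj0] : exists j, x 0 j != 0.
  apply/existsP; apply: contra_neqT x0 => /existsPn x0.
  by apply/rowP => j; rewrite mxE; apply/eqP/negbNE/x0.
rewrite (bigD1 j)//= ltr_wpDr ?sumr_ge0//; last first.
  by rewrite mxE -expr2 exprn_even_gt0.
by move=> k _; rewrite mxE -expr2 sqr_ge0.
Qed.

Lemma posdefmx_unit p (A : 'M[R]_p) : posdefmx A -> A \in unitmx.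
Proof.
move=> [_ Apos]; rewrite -row_free_unit -kermx_eq0; apply/rowV0P => x.
move=> /sub_kermxP xA0; apply/eqP/negPn/negP => /Apos.
by rewrite /quad_form xA0 mul0mx mxE ltxx.
Qed.

Lemma posdefmxV p (A : 'M[R]_p) : posdefmx A -> posdefmx (invmx A).
Proof.
move=> pA; have uA := posdefmx_unit pA; have [As Apos] := pA.
split=> [|x x0]; first by rewrite trmx_inv As.
have -> : quad_form (invmx A) x = quad_form A (x *m invmx A).
  by rewrite /quad_form trmx_mul trmx_inv As mulmxKV// mulmxA.
apply: Apos; apply: contra_neq x0 => /(congr1 (mulmx^~ A)).
by rewrite mulmxKV// mul0mx.
Qed.

Lemma measurable_quad_form p (A : 'M[R]_p) :
  measurable_fun [set: 'rV[R]_p] (quad_form A).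
Proof.
rewrite /quad_form.
apply: (eq_measurable_fun (fun x : 'rV[R]_p =>
    \sum_j (\sum_i x 0 i * A i j) * x 0 j)).
  by move=> x _; rewrite mxE; apply: eq_bigr => j _; rewrite !mxE.
apply: measurable_sum => j; apply: measurable_funM; last exact: measurable_entry.
apply: measurable_sum => i; apply: measurable_funM => //.
exact: measurable_entry.
Qed.

End definiteness.

Section gaussian_integral.
Context {R : realType}.

Let integral_gauss1 (a c k : R) : 0 < a ->
  (\int[@lebesgue_measure R]_x
     (expR (- (a * (x + c) ^+ 2 + k) / 2))%:E)%E =
  (Num.sqrt (2 * pi / a) * expR (- k / 2))%:E.
Proof.
move=> a0; pose s : R := Num.sqrt a^-1.
have s0 : s != 0 by rewrite gt_eqF// sqrtr_gt0 invr_gt0.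
have sE : s ^+ 2 = a^-1 by rewrite sqr_sqrtr// invr_ge0 ltW.
have peak : normal_peak s = (Num.sqrt (2 * pi / a))^-1.
  by rewrite /normal_peak sE mulrC -[in RHS]mulrA mulr_natl mulrnAl.
have pk0 : 0 < Num.sqrt (2 * pi / a) :> R.
  by rewrite sqrtr_gt0 divr_gt0// mulr_gt0// pi_gt0.
rewrite (_ : (fun x => _) = (fun x : measurableTypeR R =>
    (Num.sqrt (2 * pi / a) * expR (- k / 2))%:E *
    (normal_pdf (- c) s x)%:E)%E); last first.
  apply/funext => x; rewrite normal_pdfE// peak /normal_fun sE opprK -EFinM.
  congr EFin; rewrite mulrACA divff ?gt_eqF// mul1r -expRD; congr expR.
  by field; rewrite gt_eqF.
rewrite integralZl//; last exact: integrable_normal_pdf.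
by rewrite integral_normal_pdf mule1.
Qed.

Lemma integral_gauss_quad p (S : 'M[R]_p) : posdefmx S ->
  0 < \det S /\
  (\int[lebesgue_rV p]_x (expR (- quad_form S x / 2))%:E)%E =
  (Num.sqrt ((2 * pi) ^+ p / \det S))%:E.
Proof.
elim: p S => [|p IH] S pS.
  split; first by rewrite det_mx00.
  rewrite integral_dirac//; last first.
    apply/measurable_EFinP/measurableT_comp => //; apply: measurable_funM => //.
    apply: measurableT_comp => //; exact: measurable_quad_form.
  rewrite diracT mul1e /quad_form mul0mx mul0mx mxE oppr0 mul0r expR0.
  by rewrite det_mx00 expr0 divr1 sqrtr1.
have [Ss Spos] := pS.
pose S1 : 'M[R]_(1 + p) := S.
pose a := S 0 0; pose b := ursubmx S1; pose D := drsubmx S1.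
have S1E : S1 = block_mx (a%:M : 'M[R]_1) b b^T D.
  rewrite -[LHS]submxK; congr block_mx.
    apply/matrixP => i j; rewrite !ord1 !mxE eqxx mulr1n /S1 /a.
    by congr (S _ _); apply/val_inj.
  by apply/matrixP => i j; rewrite !mxE /S1 -[in LHS]Ss mxE.
have Ds : D^T = D by apply/matrixP => i j; rewrite !mxE /S1 -[in RHS]Ss mxE.
pose c (v : 'rV[R]_p) := a^-1 * (v *m b^T) 0 0.
pose S' := D - a^-1 *: (b^T *m b).
have a0 : 0 < a.
  have := Spos (delta_mx 0 0).
  rewrite /quad_form -rowE trmx_delta -colE !mxE; apply.
  by apply/eqP => /rowP/(_ 0); rewrite !mxE !eqxx => /eqP; rewrite oner_eq0.
have qE x v : quad_form S (row_cons (x, v)) = a * (x + c v) ^+ 2 + quad_form S' v.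
  pose t := (v *m b^T) 0 0; pose d := (v *m D *m v^T) 0 0.
  have vb : v *m b^T = t%:M by rewrite [LHS]mx11_scalar.
  have bv : b *m v^T = t%:M by rewrite -[LHS]trmxK trmx_mul trmxK vb tr_scalar_mx.
  have vDv : v *m D *m v^T = d%:M by rewrite [LHS]mx11_scalar.
  have -> : quad_form S' v = d - a^-1 * t ^+ 2.
    rewrite /quad_form mulmxBr mulmxBl vDv -scalemxAr -scalemxAl mulmxA vb.
    by rewrite -mulmxA bv !mxE big_ord1 !mxE eqxx !mulr1n expr2.
  have -> : quad_form S (row_cons (x, v)) = x * a * x + t * x + (x * t + d).
    rewrite -[quad_form S _]/((row_mx (x%:M : 'M[R]_1) v *m S1 *m
      (row_mx (x%:M : 'M[R]_1) v)^T) 0 0) S1E.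
    rewrite mul_row_block tr_row_mx mul_row_col.
    rewrite !mulmxDl vb vDv -!mulmxA bv tr_scalar_mx -!scalar_mxM -!raddfD /=.
    by rewrite mxE eqxx mulr1n mulrA.
  by rewrite /c -/t; field; rewrite gt_eqF.
have pS' : posdefmx S'.
  split=> [|v v0].
    by rewrite /S' linearB/= linearZ/= trmx_mul trmxK Ds.
  have := Spos (row_cons (- c v, v)); rewrite qE addNr expr0n mulr0 add0r; apply.
  apply: contra_neq v0 => /(congr1 (@row_split R p)).
  by rewrite row_consK => -[_ ->]; rewrite /row_split/=; apply/rowP => j; rewrite !mxE.
have [dS' IS'] := IH _ pS'.
have dSE : \det S = a * \det S'.
  have -> : \det S = \det (block_mx 1%:M 0 (a^-1 *: b^T) 1%:M *m
      block_mx (a%:M : 'M[R]_1) b 0 S').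
    rewrite -/S1 S1E mulmx_block !mul0mx !mul1mx !addr0.
    rewrite mul_mx_scalar scalerA divff ?gt_eqF// scale1r.
    by rewrite /S' -scalemxAl addrC subrK.
  by rewrite det_mulmx det_lblock !det1 !mul1r det_ublock det_scalar1.
split; first by rewrite dSE mulr_gt0.
have mS : measurable_fun [set: 'rV[R]_p.+1]
    (fun x => (expR (- quad_form S x / 2))%:E).
  apply/measurable_EFinP/measurableT_comp => //; apply: measurable_funM => //.
  by apply: measurableT_comp => //; exact: measurable_quad_form.
transitivity (\int[(@lebesgue_measure R) \x (lebesgue_rV p)]_z
    (expR (- quad_form S (row_cons z) / 2))%:E)%E.
  by rewrite [LHS]ge0_integral_pushforward.
rewrite (fubini_tonelli2 (m1:=@lebesgue_measure R) (m2:=lebesgue_rV p)); last 2 first.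
- exact: (measurableT_comp mS (@measurable_row_cons R p)).
- by move=> x; rewrite lee_fin expR_ge0.
rewrite /fubini_G.
under eq_integral => v _.
  under eq_integral => x _ do rewrite /= qE.
  rewrite integral_gauss1// EFinM.
  over.
rewrite ge0_integralZl//; last first.
  apply/measurable_EFinP/measurableT_comp => //; apply: measurable_funM => //.
  by apply: measurableT_comp => //; exact: measurable_quad_form.
rewrite IS' -EFinM -sqrtrM.
  by congr (Num.sqrt _)%:E; rewrite dSE exprS; field; rewrite !gt_eqF.
by rewrite divr_ge0 ?mulr_ge0 ?pi_ge0// ltW.
Qed.

End gaussian_integral.

Section multivariate_normal.
Context {R : realType}.

(* Density of N(0, Sigma) on R^p, for Sigma positive definite. *)
Definition mvnormal_pdf p (Sigma : 'M[R]_p) (x : 'rV[R]_p) : R :=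
  (Num.sqrt ((2 * pi) ^+ p * \det Sigma))^-1 *
  expR (- quad_form (invmx Sigma) x / 2).

Lemma mvnormal_pdf_ge0 p (Sigma : 'M[R]_p) x : 0 <= mvnormal_pdf Sigma x.
Proof. by rewrite mulr_ge0// ?expR_ge0// invr_ge0 sqrtr_ge0. Qed.

Lemma measurable_mvnormal_pdf p (Sigma : 'M[R]_p) :
  measurable_fun [set: 'rV[R]_p] (mvnormal_pdf Sigma).
Proof.
apply: measurable_funM => //; apply: measurableT_comp => //.
apply: measurable_funM => //; apply: measurableT_comp => //.
exact: measurable_quad_form.
Qed.

Lemma integral_mvnormal_pdf p (Sigma : 'M[R]_p) : posdefmx Sigma ->
  (\int[lebesgue_rV p]_x (mvnormal_pdf Sigma x)%:E = 1)%E.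
Proof.
move=> pS; have [dV0 IV] := integral_gauss_quad (posdefmxV pS).
under eq_integral do rewrite EFinM.
rewrite ge0_integralZl//; last first.
  apply/measurable_EFinP/measurableT_comp => //; apply: measurable_funM => //.
  by apply: measurableT_comp => //; exact: measurable_quad_form.
rewrite [X in (_ * X)%E]IV -EFinM det_inv invrK mulVf// gt_eqF// sqrtr_gt0.
by rewrite mulr_gt0 ?exprn_gt0 ?mulr_gt0 ?pi_gt0//; move: dV0; rewrite det_inv invr_gt0.
Qed.

(* The law N(0, Sigma); as a junk value it is N(0, 1) when Sigma is not
   positive definite, so that it is always a probability. *)
Definition mvnormal_prob p (Sigma : 'M[R]_p) : set 'rV[R]_p -> \bar R :=
  let S := if `[< posdefmx Sigma >] then Sigma else 1%:M in
  fun A => (\int[lebesgue_rV p]_(x in A) (mvnormal_pdf S x)%:E)%E.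

Lemma mvnormal_probE p (Sigma : 'M[R]_p) A : posdefmx Sigma ->
  mvnormal_prob Sigma A =
  (\int[lebesgue_rV p]_(x in A) (mvnormal_pdf Sigma x)%:E)%E.
Proof. by move=> pS; rewrite /mvnormal_prob asboolT. Qed.

Section mvnormal_probability.
Variables (p : nat) (Sigma : 'M[R]_p).
Local Notation mvnormal_prob := (mvnormal_prob Sigma).

Let mvnormal0 : mvnormal_prob set0 = 0%E.
Proof. by rewrite /mvnormal_prob integral_set0. Qed.

Let mvnormal_ge0 A : (0 <= mvnormal_prob A)%E.
Proof. by apply: integral_ge0 => x _; rewrite lee_fin mvnormal_pdf_ge0. Qed.

Let mvnormal_sigma_additive : semi_sigma_additive mvnormal_prob.
Proof.
move=> F mF tF mUF; rewrite /mvnormal_prob ge0_integral_bigcup//.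
- apply: is_cvg_ereal_nneg_natsum_cond => k _ _.
  by apply: integral_ge0 => x _; rewrite lee_fin mvnormal_pdf_ge0.
- apply: measurable_funTS; apply/measurable_EFinP.
  exact: measurable_mvnormal_pdf.
- by move=> x _; rewrite lee_fin mvnormal_pdf_ge0.
Qed.

HB.instance Definition _ := isMeasure.Build _ _ _ mvnormal_prob
  mvnormal0 mvnormal_ge0 mvnormal_sigma_additive.

Let mvnormal_setT : mvnormal_prob setT = 1%E.
Proof.
apply: integral_mvnormal_pdf; case: ifPn => [/asboolP //|_].
exact: posdefmx1.
Qed.

HB.instance Definition _ := @Measure_isProbability.Build _ _ R mvnormal_prob
  mvnormal_setT.

End mvnormal_probability.
End multivariate_normal.

Section iid_rows.
Context {R : realType} {p : nat}.

Definition mx_cons n (rM : 'rV[R]_p * 'M[R]_(n, p)) : 'M[R]_(1 + n, p) :=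
  col_mx rM.1 rM.2.

Lemma measurable_mx_cons n : measurable_fun setT (@mx_cons n).
Proof.
apply/measurable_fun_mxP => i j; rewrite /mx_cons.
case: (split_ordP i) => k ->.
  apply: (eq_measurable_fun
    (fun rM : 'rV[R]_p * 'M[R]_(n, p) => rM.1 k j)).
    by move=> x _; rewrite col_mxEu.
  exact: (measurableT_comp (measurable_entry k j) measurable_fst).
apply: (eq_measurable_fun (fun rM : 'rV[R]_p * 'M[R]_(n, p) => rM.2 k j)).
  by move=> x _; rewrite col_mxEd.
exact: (measurableT_comp (measurable_entry k j) measurable_snd).
Qed.

HB.instance Definition _ n := isMeasurableFun.Build _ _ _ _ (@mx_cons n)
  (@measurable_mx_cons n).

(* Joint law of the n x p matrix whose rows are independent with law P. *)
Fixpoint iid_rows (P : probability 'rV[R]_p R) n :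
    probability 'M[R]_(n, p) R :=
  if n is k.+1 then
    distribution (P \x iid_rows P k)%E (@mx_cons k)
  else \d_(0 : 'M[R]_(0, p)).

Lemma measurable_row n (i : 'I_n) :
  measurable_fun setT (fun X : 'M[R]_(n, p) => row i X).
Proof.
apply/measurable_fun_mxP => k j.
apply: (eq_measurable_fun (fun X : 'M[R]_(n, p) => X i j)).
  by move=> X _; rewrite mxE.
exact: measurable_entry.
Qed.

Lemma iid_rowsE P n (B : 'I_n -> set 'rV[R]_p) :
  (forall i, measurable (B i)) ->
  iid_rows P n [set X | forall i, B i (row i X)] = (\prod_i P (B i))%E.
Proof.
elim: n B => [|n IH] B mB.
  rewrite big_ord0 /= diracE (_ : _ \in _ = true)//.
  by apply/mem_set => -[].
rewrite big_ord_recl -IH//.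
rewrite -product_measure1E//; last first.
  rewrite [X in measurable X](_ : _ = \bigcap_(i in setT)
     ((fun X : 'M[R]_(n, p) => row i X) @^-1` B (lift ord0 i))); last first.
    by apply/seteqP; split=> [X XB i _|X XB i]; exact: XB.
  apply: fin_bigcap_measurable; first exact: finite_finset.
  by move=> i _; rewrite -[X in measurable X]setTI; exact: measurable_row.
have e0 : lshift n 0 = ord0 :> 'I_(1 + n) by exact/val_inj.
have eS k : rshift 1 k = lift ord0 k :> 'I_(1 + n) by exact/val_inj.
have row0 r X : row (ord0 : 'I_(1 + n)) (mx_cons (r, X)) = r.
  by rewrite -e0 rowKu row_id.
have rowS r X k : row (lift ord0 k : 'I_(1 + n)) (mx_cons (r, X)) = row k X.
  by rewrite -eS rowKd.
rewrite /= /distribution /pushforward; congr (_ _).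
apply/seteqP; split=> [[r X] /= rXB|[r X] /= [rB XB] i].
  split=> [|i]; first by have := rXB ord0; rewrite row0.
  by have := rXB (lift ord0 i); rewrite rowS.
by case: (unliftP ord0 i) => [k|] ->; rewrite ?row0 ?rowS.
Qed.

End iid_rows.

Section minimax.
Context {R : realType}.

Definition mclass p (Theta : 'M[R]_p) : Prop :=
  psdmx Theta /\ forall j k, j != k -> Theta j k <= 0.

Definition mxdot p (A B : 'M[R]_p) : R := \tr (A^T *m B).

Definition stein_ssym p (Theta Theta' : 'M[R]_p) : R :=
  (2 * p%:R)^-1 * mxdot (Theta - Theta') (invmx Theta' - invmx Theta).

(* For p >= 2 the set of correlations is finite and nonempty, so that its sup
   is its maximum. *)
Definition gamma_corr p (Sigma : 'M[R]_p) : R :=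
  (1 - sup [set r : R | exists j k, j != k /\
              r = Sigma j k / Num.sqrt (Sigma j j * Sigma k k)])^-1.

Definition mclass_gamma p (gamma : R) : set 'M[R]_p :=
  [set Theta | [/\ mclass Theta, Theta \in unitmx &
                   gamma_corr (invmx Theta) <= gamma]].

Definition estimator n p : set ('M[R]_(n, p) -> 'M[R]_p) :=
  [set T | measurable_fun setT T /\ forall X, posdefmx (T X)].

Definition risk n p (T : 'M[R]_(n, p) -> 'M[R]_p) (Theta : 'M[R]_p) : \bar R :=
  'E_(iid_rows (mvnormal_prob (invmx Theta)) n)
    [fun X => stein_ssym (T X) Theta].

Definition minimax_risk n p (gamma : R) : \bar R :=
  ereal_inf [set ereal_sup [set risk T Theta | Theta in @mclass_gamma p gamma]
            | T in @estimator n p].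

End minimax.

(* Main.v *)
(* The hypotheses are Theta_w = 1 - a B_w, where B_w is the adjacency matrix of
   a bipartite s-regular graph assembled from s^2 matchings of size k, with
   s ~ sqrt (n / ln p), 2 s k ~ p and a ~ 1 / s: the rows of a B_w sum to a
   small constant, which makes Theta_w a well conditioned M-matrix and bounds
   the correlations, while the squared Frobenius distance between two
   hypotheses is of order a^2 times the number of edges on which they differ.
   If an estimate has loss below tau at both Theta_w and Theta_w', then w and
   w' agree on at least half of the edges (a triangle inequality for the Stein
   loss), so each estimate is tau-good for few of the (k!)^(s^2) hypotheses.
   The likelihood ratio of N(0, Theta_w^-1)^n to N(0, 1)^n has second moment at
   most exp (n |a B_w|_F^2) under N(0, 1)^n, which this count beats when
   p >= c n^2, so some hypothesis is missed with probability at least 1/2. *)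

Require Import Defs.
From mathcomp Require Import all_boot all_order all_algebra.
From mathcomp Require Import all_classical all_reals all_analysis.
From mathcomp Require Import perm measurable_realfun ring lra.

Set Implicit Arguments.
Unset Strict Implicit.
Unset Printing Implicit Defensive.

Import Order.TTheory GRing.Theory Num.Theory.
Import numFieldNormedType.Exports HBNNSimple.

Local Open Scope classical_set_scope.
Local Open Scope ring_scope.

(** * Quadratic forms and the Stein loss *)

(** The Loewner order. Only quadratic forms are compared, so symmetry is carried as a separate
    hypothesis. *)
Definition lemx (R : realType) p (A B : 'M[R]_p) : Prop :=
  forall x : 'rV[R]_p, quad_form A x <= quad_form B x.

Lemma quad_formD (R : realType) p (A B : 'M[R]_p) x :
  quad_form (A + B) x = quad_form A x + quad_form B x.
Proof. by rewrite /quad_form mulmxDr mulmxDl mxE. Qed.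

Lemma quad_formZ (R : realType) p a (A : 'M[R]_p) x :
  quad_form (a *: A) x = a * quad_form A x.
Proof. by rewrite /quad_form -scalemxAr -scalemxAl mxE. Qed.

Lemma quad_formN (R : realType) p (A : 'M[R]_p) x :
  quad_form (- A) x = - quad_form A x.
Proof. by rewrite -scaleN1r quad_formZ mulN1r. Qed.

Lemma quad_formB (R : realType) p (A B : 'M[R]_p) x :
  quad_form (A - B) x = quad_form A x - quad_form B x.
Proof. by rewrite quad_formD quad_formN. Qed.

Lemma quad_form0 (R : realType) p (A : 'M[R]_p) : quad_form A 0 = 0.
Proof. by rewrite /quad_form !mul0mx mxE. Qed.

Lemma quad_form_conj (R : realType) m p (U : 'M[R]_(m, p)) (A : 'M[R]_p) x :
  quad_form (U *m A *m U^T) x = quad_form A (x *m U).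
Proof. by rewrite /quad_form trmx_mul !mulmxA. Qed.

Definition sqnorm (R : realType) p (x : 'rV[R]_p) : R := \sum_j x 0 j ^+ 2.

Lemma sqnorm_ge0 (R : realType) p (x : 'rV[R]_p) : 0 <= sqnorm x.
Proof. by rewrite sumr_ge0// => j _; rewrite sqr_ge0. Qed.

Lemma quad_form_scalar (R : realType) p a (x : 'rV[R]_p) :
  quad_form a%:M x = a * sqnorm x.
Proof.
rewrite -scalemx1 quad_formZ /quad_form mulmx1 mxE; congr (_ * _).
by apply: eq_bigr => j _; rewrite mxE -expr2.
Qed.

Lemma quad_form1 (R : realType) p (x : 'rV[R]_p) : quad_form 1%:M x = sqnorm x.
Proof. by rewrite quad_form_scalar mul1r. Qed.

Lemma posdefmx_quad_ge0 (R : realType) p (A : 'M[R]_p) x :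
  posdefmx A -> 0 <= quad_form A x.
Proof.
move=> [_ A0]; have [->|x0] := eqVneq x 0; first by rewrite quad_form0.
exact/ltW/A0.
Qed.

Lemma lemx_posdef (R : realType) p (A : 'M[R]_p) lo :
  0 < lo -> A^T = A -> lemx lo%:M A -> posdefmx A.
Proof.
move=> lo0 As loA; split=> // x x0; apply: lt_le_trans (loA x).
by rewrite quad_form_scalar -quad_form1 mulr_gt0//; apply: (@posdefmx1 R p).2.
Qed.

(** * Traces, Cholesky factors and determinants *)

Lemma mxtrace_quad_form (R : realType) m p (V : 'M[R]_(m, p)) (Q : 'M[R]_p) :
  (\tr (V *m Q *m V^T)) = \sum_i quad_form Q (row i V).
Proof.
apply: eq_bigr => i _; rewrite /quad_form -row_mul !mxE.
by apply: eq_bigr => j _; rewrite !mxE.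
Qed.

Lemma lemx_trace_conj (R : realType) m p (V : 'M[R]_(m, p)) (A B : 'M[R]_p) :
  lemx A B -> (\tr (V *m A *m V^T) <= \tr (V *m B *m V^T)).
Proof. by move=> AB; rewrite !mxtrace_quad_form ler_sum. Qed.

Lemma schur_posdefmx (R : realType) p (a : R) (b : 'rV[R]_p) (D : 'M[R]_p) :
  posdefmx (block_mx (a%:M : 'M[R]_1) b b^T D) ->
  0 < a /\ posdefmx (D - a^-1 *: (b^T *m b)).
Proof.
move=> [Ss S0]; have a0 : 0 < a.
  have := S0 (row_mx 1%:M 0).
  rewrite /quad_form mul_row_block tr_row_mx mul_row_col !mul0mx !addr0 !mul1mx.
  rewrite trmx0 mulmx0 addr0 trmx1 mulmx1 mxE eqxx mulr1n; apply.
  apply/eqP => /(congr1 lsubmx); rewrite row_mxKl linear0 => /matrixP/(_ 0 0).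
  by rewrite !mxE eqxx => /eqP; rewrite oner_eq0.
split=> //; have [_ _ _ Ds] : [/\ (a%:M : 'M[R]_1)^T = a%:M, b^T^T = b, b^T = b^T & D^T = D].
  by move: Ss; rewrite tr_block_mx => /eq_block_mx[].
split=> [|x x0].
  by rewrite linearB/= linearZ/= trmx_mul trmxK Ds.
(* For fixed [x] this first coordinate minimises the form, and the minimum is the form of the Schur
   complement. *)
have := S0 (row_mx (- a^-1 *: (x *m b^T)) x).
rewrite (_ : quad_form _ _ = quad_form (D - a^-1 *: (b^T *m b)) x).
  apply; apply: contra_neq x0 => /(congr1 rsubmx).
  by rewrite row_mxKr linear0.
rewrite /quad_form mul_row_block tr_row_mx mul_row_col; congr (_ _ 0 0).
rewrite mul_mx_scalar scalerA mulrN divff ?gt_eqF// scaleN1r addNr mul0mx add0r.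
by congr (_ *m _); rewrite mulmxBr addrC -scalemxAr -scalemxAl mulmxA scaleNr.
Qed.

Lemma cholesky (R : realType) p (A : 'M[R]_p) : posdefmx A ->
  exists2 V : 'M[R]_p, is_trig_mx V & A = V *m V^T.
Proof.
elim: p A => [|p IH] A pA.
  by exists 0; [exact: mx0_is_trig | apply/matrixP => -[]].
pose A1 : 'M[R]_(1 + p) := A.
pose a := ulsubmx A1 0 0; pose b := ursubmx A1; pose D := drsubmx A1.
have As := pA.1.
have A1E : A1 = block_mx (a%:M : 'M[R]_1) b b^T D.
  rewrite -[LHS]submxK; congr block_mx; first exact: mx11_scalar.
  by rewrite /b trmx_ursub [in RHS]/A1 As.
have [a0 pS] : 0 < a /\ posdefmx (D - a^-1 *: (b^T *m b)).
  by apply: schur_posdefmx; rewrite -A1E.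
have [V Vt VE] := IH _ pS.
(* The factor [V] of the Schur complement is bordered by the first column of [A] divided by
   [Num.sqrt a]. *)
pose W : 'M[R]_(1 + p) :=
  block_mx (Num.sqrt a)%:M 0 ((Num.sqrt a)^-1 *: b^T) V.
have Wt : is_trig_mx W by rewrite /W is_trig_block_mx// eqxx mx11_is_trig.
exists W => //; suff : A1 = W *m W^T by [].
rewrite A1E /W tr_block_mx mulmx_block trmx0 !mulmx0 !mul0mx !addr0.
rewrite tr_scalar_mx !linearZ/= trmxK mul_mx_scalar mul_scalar_mx.
rewrite scale_scalar_mx -expr2 sqr_sqrtr ?ltW//.
rewrite -VE mul_mx_scalar -!scalemxAl !scalerA.
rewrite mulVf ?divff ?gt_eqF ?sqrtr_gt0// !scale1r.
by rewrite -invfM -expr2 sqr_sqrtr ?ltW// addrC subrK.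
Qed.

(** With [T = V *m V^T], cyclicity turns both sides into traces of conjugates by [V^T]. *)
Lemma lemx_trace (R : realType) p (T A B : 'M[R]_p) : posdefmx T ->
  lemx A B -> \tr (T *m A) <= \tr (T *m B).
Proof.
move=> /cholesky[V _ ->] /(lemx_trace_conj V^T).
by rewrite trmxK -!(mxtrace_mulC V) !mulmxA.
Qed.

(** For a triangular [V] with [A = V *m V^T], the determinant is the product of the [V i i ^+ 2],
    each at most [expR (V i i ^+ 2 - 1)]; their sum is at most [\tr A], the squared Frobenius norm
    of [V]. *)
Lemma posdefmx_det_le (R : realType) p (A : 'M[R]_p) : posdefmx A ->
  \det A <= expR (\tr A - p%:R).
Proof.
move=> /cholesky[V Vt ->]; rewrite det_mulmx det_tr det_trig// -big_split/=.
apply: (@le_trans _ _ (\prod_i expR (V i i ^+ 2 - 1))).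
  apply: ler_prod => i _; rewrite -expr2 sqr_ge0/=.
  by have := expR_ge1Dx (V i i ^+ 2 - 1); rewrite addrC subrK.
rewrite -expR_sum ler_expR sumrB sumr_const card_ord lerD2r.
apply: ler_sum => i _; rewrite mxE (bigD1 i)//= mxE -expr2 lerDl.
by apply: sumr_ge0 => j _; rewrite mxE -expr2 sqr_ge0.
Qed.

(** * Bounds on inverses in the Loewner order *)

(** The difference of the two sides is [(invmx T - S) *m T *m (invmx T - S)]. For invertible [S],
    the left side is the tangent at [T = invmx S] of the operator convex map [invmx]; being affine
    in [T], it can be averaged. *)
Lemma lemx_inv_tangent (R : realType) p (T S : 'M[R]_p) : posdefmx T ->
  S^T = S -> lemx (2 *: S - S *m T *m S) (invmx T).
Proof.
move=> pT Ss x; rewrite -subr_ge0 -quad_formB.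
have Tu := posdefmx_unit pT.
suff -> : invmx T - (2 *: S - S *m T *m S) =
    (invmx T - S) *m T *m (invmx T - S)^T.
  by rewrite quad_form_conj; exact: posdefmx_quad_ge0.
have -> : (invmx T - S)^T = invmx T - S by rewrite linearB/= trmx_inv pT.1 Ss.
rewrite mulmxBl mulVmx// mulmxBr !mulmxBl.
rewrite !mul1mx mulmxK// scaler_nat mulr2n; apply/matrixP => i j; rewrite !mxE; ring.
Qed.

Lemma lemx_inv_ge (R : realType) p (T : 'M[R]_p) hi : 0 < hi ->
  posdefmx T -> lemx T hi%:M -> lemx (hi^-1)%:M (invmx T).
Proof.
move=> hi0 pT Thi x.
apply: le_trans (lemx_inv_tangent (S := (hi^-1)%:M) pT (tr_scalar_mx _ _) x).
rewrite mul_scalar_mx mul_mx_scalar quad_formB !quad_formZ quad_form_scalar.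
have := Thi x; rewrite quad_form_scalar => {}Thi.
rewrite -subr_ge0.
rewrite (_ : _ - _ = hi^-1 ^+ 2 * (hi * sqnorm x - quad_form T x)).
  by rewrite mulr_ge0 ?sqr_ge0// subr_ge0.
by field; rewrite gt_eqF.
Qed.

(** Two inequalities are combined: [lo T^-2 <= T^-1], the hypothesis tested at [x *m invmx T], and
    [(1 - lo T^-1)^2 >= 0]. *)
Lemma lemx_inv_le (R : realType) p (T : 'M[R]_p) lo : 0 < lo ->
  posdefmx T -> lemx lo%:M T -> lemx (invmx T) (lo^-1)%:M.
Proof.
move=> lo0 pT loT x; have Tu := posdefmx_unit pT.
have Ti : (invmx T)^T = invmx T by rewrite trmx_inv pT.1.
have q1 : quad_form (invmx T *m invmx T) x = sqnorm (x *m invmx T).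
  by rewrite -quad_form1 -quad_form_conj mulmx1 Ti.
have := loT (x *m invmx T); rewrite quad_form_scalar -q1.
rewrite -quad_form_conj Ti mulVmx// mul1mx => loT1.
have := sqnorm_ge0 (x *m (1%:M - lo *: invmx T)).
rewrite -quad_form1 -quad_form_conj mulmx1.
have -> : (1%:M - lo *: invmx T)^T = 1%:M - lo *: invmx T.
  by rewrite linearB/= trmx1 linearZ/= Ti.
rewrite mulmxBl mul1mx mulmxBr mulmx1 -scalemxAl -scalemxAr.
rewrite !(quad_formB, quad_formZ) quad_form1 => h.
have {}loT1 := ler_wpM2l (ltW lo0) loT1.
rewrite quad_form_scalar ler_pdivlMl//; lra.
Qed.

(** * Lower bounds for the Stein loss *)

Lemma mxtrace_stein (R : realType) p (T U : 'M[R]_p) : posdefmx T -> posdefmx U ->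
  mxdot (T - U) (invmx U - invmx T) =
  \tr (T *m invmx U) + \tr (invmx T *m U) - 2 * p%:R.
Proof.
move=> pT pU; have [Tu Uu] := (posdefmx_unit pT, posdefmx_unit pU).
rewrite /mxdot [(T - U)^T]linearB/= pT.1 pU.1 mulmxBl !mulmxBr !mulmxV// !linearB/=.
rewrite (mxtrace_mulC U (invmx T)) mxtrace1; ring.
Qed.

(** The difference of inverses is [invmx U2 *m D *m invmx U1], and both inverses are at least 1/2.
    Factoring [invmx U1] as [V *m V^T] lets cyclicity expose conjugations, so that the two bounds
    apply one after the other. *)
Lemma stein_lower (R : realType) p (U1 U2 : 'M[R]_p) :
  posdefmx U1 -> posdefmx U2 -> lemx U1 2%:M -> lemx U2 2%:M ->
  mxdot (U1 - U2) (U1 - U2) / 4 <= mxdot (U1 - U2) (invmx U2 - invmx U1).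
Proof.
move=> p1 p2 U1le U2le; set D := U1 - U2.
have Ds : D^T = D by rewrite /D linearB/= p1.1 p2.1.
have [u1 u2] := (posdefmx_unit p1, posdefmx_unit p2).
have pi1 := posdefmxV p1.
have [V _ VE] := cholesky pi1.
have -> : invmx U2 - invmx U1 = invmx U2 *m D *m invmx U1.
  by rewrite /D mulmxBr mulVmx// mulmxBl mul1mx mulmxK.
have i2 := lemx_trace_conj (V^T *m D) (lemx_inv_ge (ltr0Sn R 1) p2 U2le).
have i1 := lemx_trace_conj D (lemx_inv_ge (ltr0Sn R 1) p1 U1le).
rewrite trmx_mul trmxK Ds !mul_mx_scalar -!scalemxAl !linearZ/= in i1 i2.
have e1 : \tr (D *m invmx U1 *m D) = \tr (V^T *m D *m (D *m V)).
  by rewrite VE !mulmxA mxtrace_mulC !mulmxA [LHS]mxtrace_mulC !mulmxA.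
have e2 : \tr (D *m (invmx U2 *m D *m invmx U1)) =
    \tr (V^T *m D *m invmx U2 *m (D *m V)).
  by rewrite VE !mulmxA [LHS]mxtrace_mulC !mulmxA.
rewrite /mxdot Ds e2; rewrite e1 in i1; lra.
Qed.

(** No square root of [K] is taken: [K] tested at [x *m (1 - K / c)] gives
    [K - 2 K^2 / c + K^3 / c^2 >= 0], and [K <= c] tested at [x *m K] gives [K^3 <= c K^2]. *)
Lemma lemx_sqr (R : realType) p (K : 'M[R]_p) c : 0 < c -> K^T = K ->
  lemx 0 K -> lemx K c%:M -> lemx (K *m K) (c *: K).
Proof.
move=> c0 Ks K0 Kc x; have c0i : 0 < c^-1 by rewrite invr_gt0.
have q1 : quad_form (K *m K) x = sqnorm (x *m K).
  by rewrite -quad_form1 -quad_form_conj mulmx1 Ks.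
have := Kc (x *m K); rewrite quad_form_scalar -q1 -quad_form_conj Ks => Kc1.
have := K0 (x *m (1%:M - c^-1 *: K)).
rewrite -!quad_form_conj mulmx0 mul0mx.
have -> : (1%:M - c^-1 *: K)^T = 1%:M - c^-1 *: K.
  by rewrite linearB/= trmx1 linearZ/= Ks.
rewrite mulmxBl mul1mx mulmxBr mulmx1 -scalemxAr mulmxBl -!scalemxAl.
rewrite -(scale0r 0) !(quad_formB, quad_formZ) mul0r => Kc2.
have {}Kc1 := ler_wpM2l (ltW (exprn_gt0 2 c0i)) Kc1.
rewrite -(ler_pM2l c0i) mulKf ?gt_eqF//.
have ec : c^-1 ^+ 2 * c = c^-1 by field; rewrite gt_eqF.
rewrite mulrA ec in Kc1; lra.
Qed.

(* The geometric mean of G^-1 and H minimises tr(T H) + tr(T^-1 G) over T;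
   S = G^-1 + (H - G^-1) / 4 is an explicit substitute for it. *)
Lemma stein_quasi_triangle (R : realType) p (T U1 U2 : 'M[R]_p) :
  posdefmx T -> U1^T = U1 -> U2^T = U2 ->
  lemx (2^-1)%:M U1 -> lemx (2^-1)%:M U2 -> lemx U1 2%:M -> lemx U2 2%:M ->
  mxdot (U1 - U2) (U1 - U2) / 16 <=
  mxdot (T - U1) (invmx U1 - invmx T) + mxdot (T - U2) (invmx U2 - invmx T).
Proof.
move=> pT s1 s2 l1 l2 h1 h2.
have half0 : 0 < 2^-1 :> R by rewrite invr_gt0.
have [p1 p2] := (lemx_posdef half0 s1 l1, lemx_posdef half0 s2 l2).
have [u1 u2] := (posdefmx_unit p1, posdefmx_unit p2).
set G := 2^-1 *: (U1 + U2); set H := 2^-1 *: (invmx U1 + invmx U2).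
have Gs : G^T = G by rewrite linearZ/= linearD/= s1 s2.
have Hs : H^T = H by rewrite linearZ/= linearD/= !trmx_inv s1 s2.
have Gl : lemx (2^-1)%:M G.
  by move=> x; rewrite quad_formZ quad_formD; have := l1 x; have := l2 x; lra.
have Gh : lemx G 2%:M.
  by move=> x; rewrite quad_formZ quad_formD; have := h1 x; have := h2 x; lra.
have pG := lemx_posdef half0 Gs Gl; have uG := posdefmx_unit pG.
have Gis : (invmx G)^T = invmx G by rewrite trmx_inv Gs.
set K := H - invmx G.
have Ks : K^T = K by rewrite linearB/= Hs Gis.
(* Convexity of inversion: the tangent bounds for [U1] and [U2] at their mean [G] are averaged. *)
have K0 : lemx 0 K.
  move=> x; have := lemx_inv_tangent p1 Gis x; have := lemx_inv_tangent p2 Gis x.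
  have : quad_form (invmx G *m G *m invmx G) x = quad_form (invmx G) x.
    by rewrite mulVmx// mul1mx.
  rewrite {2}/G -scalemxAr -scalemxAl mulmxDr mulmxDl.
  rewrite -(scale0r 0) !(quad_formZ, quad_formB, quad_formD) mul0r; lra.
have K2 : lemx K 2%:M.
  move=> x; rewrite quad_formB quad_formZ quad_formD.
  have := lemx_inv_le half0 p1 l1 x; have := lemx_inv_le half0 p2 l2 x.
  have := posdefmx_quad_ge0 x (posdefmxV pG); rewrite invrK; lra.
(* The defining equations are kept as hypotheses and the bodies cleared, so that each unfolding
   below is explicit. *)
have KE : K = H - invmx G by [].
have HE : H = 2^-1 *: (invmx U1 + invmx U2) by [].
have GE : G = 2^-1 *: (U1 + U2) by [].
clearbody K H G.
set S := invmx G + 4^-1 *: K.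
have Ss : S^T = S by rewrite linearD/= linearZ/= Gis Ks.
(* Here [S G S = G^-1 + K / 2 + K G K / 16], and [K G K <= 2 K^2 <= 4 K], so that the sum is at most
   [G^-1 + 3 K / 4]. The weight 1/4 in [S] leaves this margin. *)
have SGS : lemx (S *m G *m S) H.
  have -> : S *m G *m S = invmx G + 2^-1 *: K + 16^-1 *: (K *m G *m K).
    rewrite /S mulmxDl mulVmx// mulmxDl mul1mx -!scalemxAl mulmxDr mulmxK//.
    rewrite -!scalemxAr; apply/matrixP => i j; rewrite !mxE; lra.
  move=> x; rewrite !(quad_formD, quad_formZ).
  have KGK : quad_form (K *m G *m K) x <= 4 * quad_form K x.
    have := Gh (x *m K); rewrite -!quad_form_conj Ks => /le_trans; apply.
    rewrite mul_mx_scalar -scalemxAl quad_formZ.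
    have := lemx_sqr (ltr0Sn R 1) Ks K0 K2 x; rewrite quad_formZ; lra.
  have := K0 x; rewrite -(scale0r 0) quad_formZ mul0r.
  move: KGK.
  have -> : H = K + invmx G by rewrite KE subrK.
  rewrite quad_formD; lra.
(* Adding [tT] and [tTi] cancels [\tr (T *m (S *m G *m S))] and leaves [\tr (T *m H) + \tr (G *m
   invmx T) >= 2 * \tr (G *m S)], a bound free of [T]. Its excess over [2 * p%:R] is
   [\tr (G *m K) / 2], where [\tr (G *m K)] is a quarter of the pairing bounded by [stein_lower]. *)
have tT := lemx_trace pT SGS.
have tTi := lemx_trace pG (lemx_inv_tangent pT Ss).
have tGS : \tr (G *m S) = p%:R + 4^-1 * \tr (G *m K).
  by rewrite mulmxDr mulmxV// linearD/= mxtrace1 -scalemxAr linearZ.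
have tGK : \tr (G *m K) = \tr (G *m H) - p%:R.
  by rewrite KE mulmxBr mulmxV// linearB/= mxtrace1.
have tGH : \tr (G *m H) = 4^-1 * (p%:R + p%:R + \tr (U1 *m invmx U2) + \tr (U2 *m invmx U1)).
  rewrite GE HE -scalemxAr -scalemxAl !linearZ/= mulmxDl !mulmxDr !mulmxV//.
  rewrite !linearD/= mxtrace1; lra.
have tS : \tr (G *m (S *m T *m S)) = \tr (T *m (S *m G *m S)).
  by rewrite mxtrace_mulC -!mulmxA mxtrace_mulC -!mulmxA.
move: tTi; rewrite mulmxBr -scalemxAr linearB/= linearZ/= tS tGS => tTi.
have := stein_lower p1 p2 h1 h2; rewrite !mxtrace_stein//.
rewrite (mxtrace_mulC (invmx U1) U2).
have tTH : \tr (T *m H) = 2^-1 * (\tr (T *m invmx U1) + \tr (T *m invmx U2)).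
  by rewrite HE -scalemxAr mulmxDr linearZ/= linearD.
have tTG : \tr (G *m invmx T) = 2^-1 * (\tr (invmx T *m U1) + \tr (invmx T *m U2)).
  by rewrite mxtrace_mulC GE -scalemxAr mulmxDr linearZ/= linearD.
rewrite tTH in tT; rewrite tTG in tTi; lra.
Qed.

(** This bounds the second moment [\det (1 - A) / sqrt (\det (1 - 2 A))] of a Gaussian likelihood
    ratio. As [(1 - A)^2 = W + A^2], the squared ratio is the determinant of a positive definite [N]
    with trace [p + \tr (W^-1 A^2)]; [posdefmx_det_le] and [W^-1 <= 2] conclude. *)
Lemma chi2_det_le (R : realType) p (A : 'M[R]_p) : A^T = A ->
  lemx (2^-1)%:M (1%:M - 2 *: A) ->
  \det (1%:M - A) <=
  expR (mxdot A A) * Num.sqrt (\det (1%:M - 2 *: A)).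
Proof.
move=> As Wl; set W := 1%:M - 2 *: A.
have half0 : 0 < 2^-1 :> R by rewrite invr_gt0.
have Ws : W^T = W by rewrite linearB/= trmx1 linearZ/= As.
have pW := lemx_posdef half0 Ws Wl.
have [V _ VE] := cholesky pW.
have uW := posdefmx_unit pW.
have uV : V \in unitmx by move: uW; rewrite VE unitmx_mul => /andP[].
set U := 1%:M - A; have Us : U^T = U by rewrite linearB/= trmx1 As.
have uU : posdefmx (U *m U).
  have pU : posdefmx U.
    apply: (lemx_posdef half0 Us) => x; have := Wl x; have := sqnorm_ge0 x.
    rewrite !quad_form_scalar !(quad_formB, quad_formZ) !quad_form_scalar; lra.
  have uU := posdefmx_unit pU.
  split=> [|x x0]; first by rewrite trmx_mul Us.
  rewrite -{2}Us -[U in U *m _]mulmx1 quad_form_conj.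
  apply: (@posdefmx1 R p).2; apply: contra_neq x0 => /(congr1 (mulmx^~ (invmx U))).
  by rewrite mulmxK// mul0mx.
pose N := invmx V *m (U *m U) *m (invmx V)^T.
have pN : posdefmx N.
  split=> [|x x0]; first by rewrite /N !trmx_mul !trmxK Us !mulmxA.
  rewrite quad_form_conj; apply: uU.2; apply: contra_neq x0.
  by move=> /(congr1 (mulmx^~ V)); rewrite mulmxKV// mul0mx.
have UU : U *m U = W + A *m A.
  rewrite /U /W mulmxBl mul1mx mulmxBr mulmx1.
  by apply/matrixP => i j; rewrite !mxE; ring.
have trN : \tr N - p%:R <= 2 * mxdot A A.
  have Wi : invmx W = (invmx V)^T *m invmx V.
    rewrite -[RHS](mulKmx uW) {3}VE -mulmxA [V^T *m _]mulmxA -trmx_mul.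
    by rewrite mulVmx// trmx1 mul1mx mulmxV// mulmx1.
  rewrite /N mxtrace_mulC mulmxA -Wi UU mulmxDr mulVmx// linearD/= mxtrace1.
  rewrite addrAC subrr add0r mulmxA mxtrace_mulC mulmxA /mxdot As.
  have := lemx_trace_conj A (lemx_inv_le half0 pW Wl).
  by rewrite As mul_mx_scalar -scalemxAl linearZ/= invrK.
have dW : 0 < \det W := (integral_gauss_quad pW).1.
have -> : expR (mxdot A A) * Num.sqrt (\det W) =
    Num.sqrt (expR (mxdot A A) ^+ 2 * \det W).
  by rewrite sqrtrM ?sqr_ge0// sqrtr_sqr ger0_norm ?expR_ge0.
have eW : 0 < expR (mxdot A A) ^+ 2 * \det W.
  by rewrite mulr_gt0// exprn_gt0// expR_gt0.
apply: le_trans (ler_norm _) _; rewrite -sqrtr_sqr ler_sqrt ?(ltW eW)//.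
have -> : \det U ^+ 2 = \det N * \det W.
  rewrite /N VE !det_mulmx !det_tr det_inv expr2; field.
  by rewrite -unitfE -unitmxE.
rewrite ler_pM2r//; apply: le_trans (posdefmx_det_le pN) _.
by rewrite -expRM_natl ler_expR.
Qed.

(** * Densities and the chi-square divergence *)

(** For a simple function the identity is the hypothesis on sets; monotone convergence along
    [nnsfun_approx] extends it to [f]. *)
Lemma integral_density d (T : measurableType d) (R : realType)
    (mu nu : {measure set T -> \bar R}) (g : T -> R) (f : T -> \bar R) :
  (forall x, 0 <= g x) -> measurable_fun setT g ->
  (forall A, measurable A -> nu A = \int[mu]_(x in A) (g x)%:E)%E ->
  (forall x, 0 <= f x)%E -> measurable_fun setT f ->
  (\int[nu]_x f x = \int[mu]_x (f x * (g x)%:E))%E.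
Proof.
move=> g0 mg nuE f0 mf.
have mgE : measurable_fun setT (EFin \o g) by exact/measurable_EFinP.
pose h := nnsfun_approx measurableT mf.
have hf x : (h k x)%:E @[k --> \oo] --> f x.
  by apply: (cvg_nnsfun_approx measurableT mf) => // y _; exact: f0.
have mh k : measurable_fun setT (fun x => (h k x)%:E).
  by apply/measurable_EFinP; exact/measurable_funP.
have mhg k : measurable_fun setT (fun x => (h k x)%:E * (g x)%:E)%E.
  exact: emeasurable_funM.
have nd x : {homo (fun k => (h k x)%:E) : a b / (a <= b)%N >-> (a <= b)%E}.
  by move=> a b ab; rewrite lee_fin; exact/lefP/nd_nnsfun_approx.
have h0 k x : (0 <= (h k x)%:E)%E by rewrite lee_fin.
have cnu : (\int[nu]_x (h k x)%:E)%E @[k --> \oo] --> (\int[nu]_x f x)%E.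
  rewrite (_ : f = (fun x => limn (fun k => (h k x)%:E))).
    apply: cvg_monotone_convergence => // x _; exact: nd.
  by apply/funext => x; apply/esym/cvg_lim => //; exact: hf.
have cmu : (\int[mu]_x ((h k x)%:E * (g x)%:E))%E @[k --> \oo] -->
    (\int[mu]_x (f x * (g x)%:E))%E.
  rewrite (_ : (fun x => f x * (g x)%:E)%E =
      (fun x => limn (fun k => ((h k x)%:E * (g x)%:E)%E))).
    apply: cvg_monotone_convergence => // [k x _|x _ a b ab].
      by rewrite mule_ge0// lee_fin.
    by apply: lee_wpmul2r; [rewrite lee_fin | exact: nd].
  apply/funext => x; apply/esym/cvg_lim => //; apply: cvgeZr => //; exact: hf.
apply: (cvg_unique _ cnu) => //; rewrite (_ : (fun k => _) = (fun k =>
  \int[mu]_x ((h k x)%:E * (g x)%:E))%E)//.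
apply/funext => k; rewrite integralT_nnsfun sintegralE.
have mB y : measurable (h k @^-1` [set y]) by exact: measurable_sfunP.
transitivity (\int[mu]_x (\sum_(y \in range (h k))
    ((y * \1_(h k @^-1` [set y]) x)%:E * (g x)%:E)))%E; last first.
  apply: eq_integral => x _; rewrite [in RHS]fimfunE -fsumEFin//.
  by rewrite ge0_mule_fsuml// => y; exact: nnfun_muleindic_ge0.
have mi y : measurable_fun setT (fun x => (y * \1_(h k @^-1` [set y]) x)%:E).
  by apply/measurable_EFinP; exact: measurable_funM.
rewrite ge0_integral_fsum//; last 2 first.
- by move=> y; exact: emeasurable_funM.
- by move=> y x _; rewrite mule_ge0 ?lee_fin//; exact: nnfun_muleindic_ge0.
apply: eq_fsbigr => y; rewrite inE => -[x _ <-]; rewrite nuE//.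
rewrite -ge0_integralZl// ?lee_fin//; last 2 first.
- exact: measurable_funTS.
- by move=> z _; rewrite lee_fin.
rewrite integral_mkcond; apply: eq_integral => z _; rewrite patchE indicE.
by case: ifP => _; rewrite ?mulr1// mulr0 mul0e.
Qed.

Lemma measurable_fun_inv d (T : measurableType d) (R : realType) (f : T -> R) :
  (forall x, 0 < f x) -> measurable_fun setT f ->
  measurable_fun setT (fun x => (f x)^-1).
Proof.
move=> f0 mf; apply: (eq_measurable_fun (fun x => f x `^ -1)) => [x _|].
  by rewrite powR_inv1// ltW.
exact: (measurableT_comp (measurable_powR (-1))).
Qed.

(* Cauchy-Schwarz in the form f <= lam f^2 / 2 + 1 / (2 lam), which tensorises:
   the induction hypothesis is used on each slice with weight lam * f x. *)
Lemma iid_rows_chi2 (R : realType) p (P Q : probability 'rV[R]_p R)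
    (f : 'rV[R]_p -> R) (c : R) :
  (forall x, 0 < f x) -> measurable_fun setT f ->
  (forall A, measurable A -> P A = \int[Q]_(x in A) (f x)%:E)%E ->
  (\int[P]_x (f x)%:E <= c%:E)%E ->
  forall n (C : set 'M[R]_(n, p)) (lam : R), measurable C -> 0 < lam ->
  (iid_rows P n C <=
   (lam / 2 * c ^+ n)%:E + (lam^-1 / 2)%:E * iid_rows Q n C)%E.
Proof.
move=> f0 mf PE Pc; elim=> [|n IH] C lam mC lam0.
  (* With no rows the law is a point mass, and what remains is [lam + lam^-1 >= 2]. *)
  rewrite /= diracE expr0 mulr1; case: (_ \in _) => /=; last first.
    by rewrite mule0 adde0 lee_fin divr_ge0// ltW.
  rewrite mule1 -EFinD lee_fin.
  have li0 : 0 <= lam^-1 by rewrite invr_ge0 ltW.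
  have := mulr_ge0 li0 (sqr_ge0 (lam - 1)).
  have -> : lam^-1 * (lam - 1) ^+ 2 = lam + lam^-1 - 2.
    by field; rewrite gt_eqF.
  lra.
set D := @mx_cons R p n @^-1` C.
have mD : measurable D.
  by rewrite -[D]setTI; exact: measurable_mx_cons.
(* By conversion, the law of [n.+1] rows integrates the law of the last [n] over the first row. *)
rewrite -[iid_rows P n.+1 C]/(\int[P]_x (iid_rows P n (xsection D x)))%E.
rewrite -[iid_rows Q n.+1 C]/(\int[Q]_x (iid_rows Q n (xsection D x)))%E.
set psi := fun x => iid_rows Q n (xsection D x).
have mphi : measurable_fun setT (fun x => iid_rows P n (xsection D x)).
  exact: measurable_fun_xsection.
have mpsi : measurable_fun setT psi by exact: measurable_fun_xsection.
have fi0 x : 0 <= (f x)^-1 by rewrite invr_ge0 ltW.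
have mfE : measurable_fun setT (fun x => (f x)%:E) by exact/measurable_EFinP.
have mfi : measurable_fun setT (fun x => ((f x)^-1)%:E).
  by apply/measurable_EFinP; exact: measurable_fun_inv.
have c0 : 0 <= c ^+ n.
  rewrite exprn_ge0// -lee_fin; apply: le_trans Pc.
  by apply: integral_ge0 => x _; rewrite lee_fin ltW.
have cl0 : 0 <= lam / 2 * c ^+ n by rewrite mulr_ge0// divr_ge0// ltW.
have li0 : 0 <= lam^-1 / 2 by rewrite divr_ge0// invr_ge0 ltW.
have psi0 x : (0 <= psi x)%E by exact: measure_ge0.
have mfpsi : measurable_fun setT (fun x => ((f x)^-1)%:E * psi x)%E.
  exact: emeasurable_funM.
apply: (@le_trans _ _ (\int[P]_x ((lam / 2 * c ^+ n)%:E * (f x)%:E +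
    (lam^-1 / 2)%:E * (((f x)^-1)%:E * psi x)))%E).
  apply: ge0_le_integral => //.
    by apply: emeasurable_funD; exact: emeasurable_funM.
  move=> x _; apply: le_trans (IH _ (lam * f x) (measurable_xsection _ mD) _) _.
    by rewrite mulr_gt0.
  rewrite -!EFinM muleA -EFinM.
  rewrite (_ : lam * f x / 2 * c ^+ n = lam / 2 * c ^+ n * f x); last by ring.
  by rewrite invfM (mulrAC lam^-1).
rewrite ge0_integralD//; last 4 first.
- by move=> x _; rewrite mule_ge0 ?lee_fin// ltW.
- exact: emeasurable_funM.
- by move=> x _; rewrite !mule_ge0 ?lee_fin.
- exact: emeasurable_funM.
rewrite ge0_integralZl//; last by move=> x _; rewrite lee_fin ltW.
rewrite ge0_integralZl//; last by move=> x _; rewrite !mule_ge0 ?lee_fin.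
(* Passing from [P] to [Q] multiplies by [f], which cancels the factor [(f x)^-1] left by the weight
   [lam * f x]. *)
rewrite (@integral_density _ _ _ Q P f (fun x => ((f x)^-1)%:E * psi x)%E)//; last 2 first.
- by move=> x; rewrite ltW.
- by move=> x; rewrite !mule_ge0 ?lee_fin.
rewrite [X in (_ + _ * X <= _)%E](eq_integral psi) => [|x _]; last first.
  by rewrite muleAC -EFinM mulVf ?mul1e// gt_eqF.
apply: leeD2r; rewrite exprSr mulrA [leRHS]EFinM.
by apply: lee_wpmul2l => //; rewrite lee_fin.
Qed.

Lemma mvnormal_pdf_gt0 (R : realType) p (S : 'M[R]_p) x :
  posdefmx S -> 0 < mvnormal_pdf S x.
Proof.
move=> pS; rewrite mulr_gt0 ?expR_gt0// invr_gt0 sqrtr_gt0 mulr_gt0//.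
  by rewrite exprn_gt0// mulr_gt0// pi_gt0.
exact: (integral_gauss_quad pS).1.
Qed.

Lemma integral_mvnormal_prob (R : realType) p (S : 'M[R]_p) (h : 'rV[R]_p -> \bar R) :
  posdefmx S -> (forall x, 0 <= h x)%E -> measurable_fun setT h ->
  (\int[mvnormal_prob S]_x h x =
   \int[lebesgue_rV p]_x (h x * (mvnormal_pdf S x)%:E))%E.
Proof.
move=> pS h0 mh.
pose nu : {measure set 'rV[R]_p -> \bar R} := mvnormal_prob S.
have nuE A : measurable A ->
    nu A = (\int[lebesgue_rV p]_(x in A) (mvnormal_pdf S x)%:E)%E.
  by move=> _; exact: mvnormal_probE.
have := @integral_density _ _ R (lebesgue_rV p) nu (mvnormal_pdf S) h
  (mvnormal_pdf_ge0 S) (@measurable_mvnormal_pdf R p S).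
move=> /(_ nuE h0 mh).
exact.
Qed.

(** [iid_rows_chi2] is applied to the likelihood ratio [f] of N(0, (1 - A)^-1) to N(0, 1). Its mean
    under the former law is its second moment under the latter, a Gaussian integral with matrix [W],
    finite because [W] is positive definite. *)
Lemma mvnormal_chi2 (R : realType) p (A : 'M[R]_p) n
    (C : set 'M[R]_(n, p)) (lam : R) :
  A^T = A -> lemx (2^-1)%:M (1%:M - 2 *: A) -> measurable C -> 0 < lam ->
  (iid_rows (mvnormal_prob (invmx (1%:M - A))) n C <=
   (lam / 2 * expR (n%:R * mxdot A A))%:E +
   (lam^-1 / 2)%:E * iid_rows (mvnormal_prob 1%:M) n C)%E.
Proof.
move=> As Wl mC lam0; set U := 1%:M - A; set W := 1%:M - 2 *: A in Wl *.
have half0 : 0 < 2^-1 :> R by rewrite invr_gt0.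
have pW : posdefmx W.
  by apply: (lemx_posdef half0) Wl; rewrite linearB/= trmx1 linearZ/= As.
have pU : posdefmx U.
  apply: (lemx_posdef half0) => [|x]; first by rewrite linearB/= trmx1 As.
  have := Wl x; have := sqnorm_ge0 x.
  rewrite !(quad_formB, quad_formZ, quad_form_scalar); lra.
have pUi := posdefmxV pU; have p1 := @posdefmx1 R p.
have f0 x : 0 < mvnormal_pdf (invmx U) x / mvnormal_pdf 1%:M x.
  by rewrite divr_gt0// mvnormal_pdf_gt0.
have mf : measurable_fun setT
    (fun x : 'rV[R]_p => mvnormal_pdf (invmx U) x / mvnormal_pdf 1%:M x).
  apply: measurable_funM; first exact: measurable_mvnormal_pdf.
  apply: measurable_fun_inv; last exact: measurable_mvnormal_pdf.
  by move=> x; exact: mvnormal_pdf_gt0.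
set f := fun x : 'rV[R]_p => _ / _ in mf.
have mfE : measurable_fun setT (EFin \o f) by exact/measurable_EFinP.
rewrite expRM_natl; apply: (@iid_rows_chi2 _ _ _ _ f) => // [B mB|].
  rewrite [LHS](mvnormal_probE B pUi) integral_mkcond.
  rewrite [RHS]integral_mkcond integral_mvnormal_prob//; last 2 first.
  - by move=> x; rewrite patchE; case: ifP => // _; rewrite lee_fin ltW// f0.
  - by apply/(measurable_restrictT _ mB); exact: measurable_funTS.
  apply: eq_integral => x _; rewrite !patchE; case: ifP => _; last by rewrite mul0e.
  by rewrite -EFinM mulfVK// gt_eqF// mvnormal_pdf_gt0.
rewrite integral_mvnormal_prob//; last by move=> x; rewrite lee_fin ltW// f0.
pose t : R := (2 * pi) ^+ p.
have t0 : 0 < t by rewrite exprn_gt0// mulr_gt0// pi_gt0.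
have dU0 : 0 < \det U := (integral_gauss_quad pU).1.
have [dW0 IW] := integral_gauss_quad pW.
(* The exponents combine since [2 U - 1 = W]. *)
rewrite (_ : integral _ _ _ = \int[lebesgue_rV p]_x
    ((\det U / Num.sqrt t)%:E * (expR (- quad_form W x / 2))%:E))%E; last first.
  apply: eq_integral => x _; rewrite -!EFinM; congr EFin.
  rewrite /f /mvnormal_pdf invmxK det_inv det1 mulr1 invmx1 -/t.
  set E1 := expR (- quad_form U x / 2); set E0 := expR (- quad_form 1%:M x / 2).
  have E11 : E1 * E1 = expR (- quad_form W x / 2) * E0.
    rewrite -!expRD; congr expR.
    rewrite /U /W !(quad_formB, quad_formZ); lra.
  have st0 : 0 < Num.sqrt t by rewrite sqrtr_gt0.
  have sd0 : 0 < Num.sqrt (\det U) by rewrite sqrtr_gt0.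
  have sdE : \det U = Num.sqrt (\det U) ^+ 2 by rewrite sqr_sqrtr// ltW.
  have E00 : 0 < E0 by exact: expR_gt0.
  have -> : expR (- quad_form W x / 2) = E1 * E1 / E0 by rewrite E11 mulfK// gt_eqF.
  rewrite sqrtrM ?(ltW t0)// sqrtrV ?(ltW dU0)// [in RHS]sdE.
  by field; rewrite !gt_eqF.
rewrite ge0_integralZl//; last 2 first.
- apply/measurable_EFinP/measurableT_comp => //; apply: measurable_funM => //.
  by apply: measurableT_comp => //; exact: measurable_quad_form.
- by rewrite lee_fin divr_ge0// ?sqrtr_ge0 ?ltW.
rewrite IW -EFinM lee_fin -/t sqrtrM ?(ltW t0)// sqrtrV ?(ltW dW0)//.
rewrite mulrA mulfVK ?gt_eqF ?sqrtr_gt0// ler_pdivrMr ?sqrtr_gt0//.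
exact: chi2_det_le.
Qed.

(** * Measurability of the loss, and an averaging argument *)

Lemma measurable_fun_det d (T : measurableType d) (R : realType) p
    (g : T -> 'M[R]_p) :
  measurable_fun setT g -> measurable_fun setT (fun x => \det (g x)).
Proof.
move=> /measurable_fun_mxP mg; apply: measurable_sum => s.
by apply: measurable_funM => //; apply: measurable_prod => i _; exact: mg.
Qed.

(** By Cramer's rule; positive definiteness keeps the determinant positive and [invmx] on its
    adjugate branch. *)
Lemma measurable_fun_invmx d (T : measurableType d) (R : realType) p
    (g : T -> 'M[R]_p) :
  (forall x, posdefmx (g x)) -> measurable_fun setT g ->
  measurable_fun setT (fun x => invmx (g x)).
Proof.
move=> pg mg; apply/measurable_fun_mxP => i j.
apply: (eq_measurable_fun (fun x => (\det (g x))^-1 * cofactor (g x) j i)).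
  by move=> x _; rewrite /invmx posdefmx_unit// !mxE.
apply: measurable_funM.
  apply: measurable_fun_inv; last exact: measurable_fun_det.
  by move=> x; exact: (integral_gauss_quad (pg x)).1.
apply: measurable_funM => //; apply: measurable_fun_det.
apply/measurable_fun_mxP => k l.
apply: (eq_measurable_fun (fun x => g x (lift j k) (lift i l))).
  by move=> x _; rewrite !mxE.
by move/measurable_fun_mxP : mg; exact.
Qed.

Lemma measurable_stein_ssym d (T : measurableType d) (R : realType) p
    (g : T -> 'M[R]_p) (U : 'M[R]_p) :
  (forall x, posdefmx (g x)) -> measurable_fun setT g ->
  measurable_fun setT (fun x => stein_ssym (g x) U).
Proof.
move=> pg mg; apply: measurable_funM => //; apply: measurable_sum => i.
apply: (eq_measurable_fun (fun x =>
    \sum_j (g x j i - U j i) * (invmx U j i - invmx (g x) j i))).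
  by move=> x _; rewrite mxE; apply: eq_bigr => j _; rewrite !mxE.
have /measurable_fun_mxP mgi := measurable_fun_invmx pg mg.
move/measurable_fun_mxP : mg => mg.
apply: measurable_sum => j; apply: measurable_funM; exact: measurable_funB.
Qed.

(** The sum of the [P (C i)] is the expected number of indices [i] with [C i x], hence at most [b];
    some term is at most the average. *)
Lemma exists_le_average d (T : measurableType d) (R : realType)
    (P : probability T R) (F : finType) (C : F -> set T) (b : nat) :
  (0 < #|F|)%N -> (forall i, measurable (C i)) ->
  (forall x, (#|[set i | `[< C i x >]]%SET| <= b)%N) ->
  exists i, (P (C i) <= (b%:R / #|F|%:R)%:E)%E.
Proof.
move=> F0 mC Cb; apply/not_existsP => h.
have Fr0 : (0 : R) < #|F|%:R by rewrite ltr0n.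
have Pr i : P (C i) = (fine (P (C i)))%:E by rewrite fineK// fin_num_measure.
have : (b%:R%:E < \sum_i P (C i))%E.
  under eq_bigr do rewrite Pr.
  rewrite sumEFin lte_fin.
  rewrite (_ : b%:R = \sum_(i in F) b%:R / #|F|%:R); last first.
    by rewrite sumr_const -[RHS]mulr_natr mulfVK// gt_eqF.
  apply: ltr_sum => [|i _]; last by rewrite -lte_fin -Pr ltNge; apply/negP/h.
  have [i0 _] := card_gt0P F0.
  by apply/hasP; exists i0; rewrite ?mem_index_enum.
apply/negP; rewrite -leNgt.
under eq_bigr do rewrite -(setIT (C _)) -integral_indic//.
rewrite -ge0_integral_sum//; last first.
  by move=> i; apply/measurable_EFinP; exact: measurable_indic.
rewrite -[leRHS]mule1 -(probability_setT P) -integral_cst//.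
apply: ge0_le_integral => //.
- by move=> x _; apply: sume_ge0.
- apply: emeasurable_sum => i; apply/measurable_EFinP; exact: measurable_indic.
move=> x _; rewrite sumEFin lee_fin.
apply: le_trans (_ : #|[set i | `[< C i x >]]%SET|%:R <= _).
  rewrite -sum1_card natr_sum [leRHS]big_mkcond/=; apply: ler_sum => i _.
  by rewrite inE indicE; case: asboolP => Cx; [rewrite mem_set|rewrite memNset].
by rewrite ler_nat.
Qed.

(** * Regular bipartite graphs *)

Lemma quad_form_delta (R : realType) p (i j : 'I_p) (x : 'rV[R]_p) :
  quad_form (delta_mx i j) x = x 0 i * x 0 j.
Proof.
rewrite /quad_form -(mul_delta_mx (0 : 'I_1)) mulmxA -mulmxA -colE -rowE.
by rewrite mxE big_ord1 !mxE.
Qed.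

Lemma quad_form_sum (R : realType) p (I : finType) (F : I -> 'M[R]_p) x :
  quad_form (\sum_i F i) x = \sum_i quad_form (F i) x.
Proof.
apply: (big_morph (fun A => quad_form A x) (fun A B => quad_formD A B x)).
by rewrite -(scale0r 0) quad_formZ mul0r.
Qed.

Lemma mxdotC (R : realType) p (A B : 'M[R]_p) : mxdot A B = mxdot B A.
Proof. by rewrite /mxdot -mxtrace_tr trmx_mul trmxK. Qed.

Lemma mxdotDl (R : realType) p (A B C : 'M[R]_p) :
  mxdot (A + B) C = mxdot A C + mxdot B C.
Proof. by rewrite /mxdot linearD/= mulmxDl linearD. Qed.

Lemma mxdotZl (R : realType) p a (A C : 'M[R]_p) :
  mxdot (a *: A) C = a * mxdot A C.
Proof. by rewrite /mxdot linearZ/= -scalemxAl linearZ. Qed.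

Lemma mxdotBl (R : realType) p (A B C : 'M[R]_p) :
  mxdot (A - B) C = mxdot A C - mxdot B C.
Proof. by rewrite mxdotDl -scaleN1r mxdotZl mulN1r. Qed.

Lemma mxdot_suml (R : realType) p (I : finType) (F : I -> 'M[R]_p) C :
  mxdot (\sum_i F i) C = \sum_i mxdot (F i) C.
Proof.
apply: (big_morph (fun A => mxdot A C) (fun A B => mxdotDl A B C)).
by rewrite -(scale0r 0) mxdotZl mul0r.
Qed.

Lemma mxdot_deltal (R : realType) p (i j : 'I_p) (B : 'M[R]_p) :
  mxdot (delta_mx i j) B = B i j.
Proof.
rewrite /mxdot trmx_delta -(mul_delta_mx (0 : 'I_1)) -mulmxA mxtrace_mulC.
by rewrite -rowE -colE trace_mx11 !mxE.
Qed.

(** The label [(u, t, l)] stands for the edge from node [l] of left group [u] to right group [t].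
    Labels do not depend on the wiring, which only decides the right endpoint. *)
Definition edge s k := ('I_s * 'I_s * 'I_k)%type.

Definition wiring s k := {ffun 'I_s * 'I_s -> {perm 'I_k}}.

Definition node s k := ('I_s * 'I_k + 'I_s * 'I_k)%type.

Definition src s k (e : edge s k) : node s k := inl (e.1.1, e.2).

Definition dst s k (w : wiring s k) (e : edge s k) : node s k :=
  inr (e.1.2, w e.1 e.2).

Definition agree s k (w w' : wiring s k) : nat :=
  \sum_(e : edge s k) (w e.1 e.2 == w' e.1 e.2).

(* Weighted adjacency matrix of a bipartite s-regular graph: on each side, the
   nodes form s groups of size k, and group u on the left is joined to
   group t on the right by the matching w (u, t). *)
Definition adjmx (R : realType) p s k (emb : node s k -> 'I_p) (a : R)
    (w : wiring s k) : 'M[R]_p :=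
  \sum_(e : edge s k) a *: (delta_mx (emb (src e)) (emb (dst w e)) +
                            delta_mx (emb (dst w e)) (emb (src e))).

Lemma agreexx s k (w : wiring s k) : agree w w = (s * s * k)%N.
Proof.
rewrite /agree (eq_bigr (fun=> 1%N)) => [|e _]; last by rewrite eqxx.
by rewrite sum1_card !card_prod !card_ord.
Qed.

Lemma adjmx_sym (R : realType) p s k emb (a : R) (w : wiring s k) :
  (@adjmx R p s k emb a w)^T = adjmx emb a w.
Proof.
rewrite linear_sum; apply: eq_bigr => e _.
by rewrite linearZ linearD/= !trmx_delta addrC.
Qed.

Lemma adjmx_ge0 (R : realType) p s k emb (a : R) (w : wiring s k) i j :
  0 <= a -> 0 <= @adjmx R p s k emb a w i j.
Proof.
move=> a0; rewrite summxE sumr_ge0// => e _.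
by rewrite !mxE mulr_ge0// addr_ge0// ler0n.
Qed.

Lemma sum_node_le (R : realType) p s k (emb : node s k -> 'I_p) (f : 'I_p -> R) :
  injective emb -> (forall i, 0 <= f i) ->
  \sum_z f (emb (inl z)) + \sum_z f (emb (inr z)) <= \sum_i f i.
Proof.
move=> emb_inj f0; rewrite -(big_sumType _ xpredT (fun z => f (emb z)))/=.
rewrite -(big_imset f (in2W emb_inj))/=.
by rewrite big_mkcond/=; apply: ler_sum => i _; case: ifP.
Qed.

(** An edge with end values [y] and [z] contributes [2 a y z], bounded by [a (y^2 + z^2)], and each
    node lies on [s] edges. *)
Lemma adjmx_quad_form (R : realType) p s k emb (a : R) (w : wiring s k) x :
  injective emb -> 0 <= a ->
  `|quad_form (@adjmx R p s k emb a w) x| <= a * s%:R * sqnorm x.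
Proof.
move=> emb_inj a0; pose f i := x 0 i ^+ 2.
have f0 i : 0 <= f i by exact: sqr_ge0.
rewrite /adjmx quad_form_sum.
apply: (@le_trans _ _ (\sum_(e : edge s k) a * (f (emb (src e)) + f (emb (dst w e))))).
  apply: le_trans (ler_norm_sum _ _ _) _; apply: ler_sum => e _.
  rewrite quad_formZ quad_formD !quad_form_delta normrM ger0_norm//.
  rewrite ler_wpM2l// /f.
  set y := x 0 _; set z := x 0 _; rewrite ler_norml.
  have := sqr_ge0 (y - z); have := sqr_ge0 (y + z); nra.
rewrite -mulr_sumr -mulrA ler_wpM2l// big_split/=.
have -> : \sum_(e : edge s k) f (emb (src e)) = s%:R * \sum_z f (emb (inl z)).
  rewrite -(pair_bigA _ (fun ut l => f (emb (inl (ut.1, l)))))/=.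
  rewrite -(pair_bigA _ (fun u t => \sum_l f (emb (inl (u, l)))))/=.
  rewrite [in RHS](eq_bigr (fun z => f (emb (inl (z.1, z.2))))) => [|[]//].
  rewrite -(pair_bigA _ (fun u l => f (emb (inl (u, l)))))/= mulr_sumr.
  by apply: eq_bigr => u _; rewrite sumr_const card_ord mulr_natl.
(* Each matching permutes the nodes of its right group, so the wiring disappears from the sum. *)
have -> : \sum_(e : edge s k) f (emb (dst w e)) = s%:R * \sum_z f (emb (inr z)).
  rewrite -(pair_bigA _ (fun ut l => f (emb (inr (ut.2, w ut l)))))/=.
  rewrite (eq_bigr (fun ut => \sum_l f (emb (inr (ut.2, l))))); last first.
    by move=> ut _; rewrite [RHS](reindex_inj (@perm_inj _ (w ut))).
  rewrite -(pair_bigA _ (fun u t => \sum_l f (emb (inr (t, l)))))/=.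
  rewrite [in RHS](eq_bigr (fun z => f (emb (inr (z.1, z.2))))) => [|[]//].
  rewrite -(pair_bigA _ (fun u l => f (emb (inr (u, l)))))/=.
  by rewrite sumr_const card_ord mulr_natl.
rewrite -mulrDr ler_wpM2l// ?ler0n//.
exact: (sum_node_le emb_inj f0).
Qed.

(** The row determines [u] and [l], the column determines [t], so among the edges of [w'] only the
    one labelled [e] can reach this entry. *)
Lemma adjmx_src_dst (R : realType) p s k emb (a : R) (w w' : wiring s k) e :
  injective emb ->
  @adjmx R p s k emb a w' (emb (src e)) (emb (dst w e)) =
  a * (w e.1 e.2 == w' e.1 e.2)%:R.
Proof.
move=> emb_inj.
have entry e' : (a *: (delta_mx (emb (src e')) (emb (dst w' e')) +
    delta_mx (emb (dst w' e')) (emb (src e'))) : 'M[R]_p)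
    (emb (src e)) (emb (dst w e)) =
    a * ((src e == src e') && (dst w e == dst w' e'))%:R.
  have sd : (src e == dst w' e') = false by [].
  by rewrite !mxE !(inj_eq emb_inj) sd addr0.
rewrite summxE (bigD1 e)//= entry eqxx big1 ?addr0 => [|e' e'e].
  congr (_ * _%:R); congr nat_of_bool.
  by apply/eqP/eqP => [[]//|we]; rewrite /dst we.
rewrite entry; case: eqP => [[ue le]|_]; last by rewrite mulr0.
case: eqP => [[te _]|_]; last by rewrite mulr0.
case/eqP: e'e; move: e e' ue le te {entry} => [[u t] l] [[u' t'] l']/=.
by move=> -> -> ->.
Qed.

Lemma mxdot_adjmx (R : realType) p s k emb (a : R) (w w' : wiring s k) :
  injective emb ->
  mxdot (@adjmx R p s k emb a w) (adjmx emb a w') = 2 * a ^+ 2 * (agree w w')%:R.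
Proof.
move=> emb_inj; rewrite [X in mxdot X _]/adjmx mxdot_suml natr_sum mulr_sumr.
apply: eq_bigr => e _; rewrite mxdotZl mxdotDl !mxdot_deltal.
have -> : adjmx emb a w' (emb (dst w e)) (emb (src e)) =
    adjmx emb a w' (emb (src e)) (emb (dst w e)).
  by rewrite -[in LHS](adjmx_sym emb a w') mxE.
rewrite adjmx_src_dst//.
by ring.
Qed.

Lemma mxdot_adjmxB (R : realType) p s k emb (a : R) (w w' : wiring s k) :
  injective emb ->
  let D := @adjmx R p s k emb a w - adjmx emb a w' in
  mxdot D D = 4 * a ^+ 2 * ((s * s * k)%:R - (agree w w')%:R).
Proof.
move=> emb_inj /=; set A := adjmx emb a w; set B := adjmx emb a w'.
rewrite mxdotBl (mxdotC A) (mxdotC B) !mxdotBl (mxdotC B) !mxdot_adjmx//.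
by rewrite !agreexx; ring.
Qed.

(** * Counting wirings *)

(** A weak form of Stirling's bound; the induction step is [(1 + 1/k)^k <= e]. *)
Lemma expn_le_fact (R : realType) k : k%:R ^+ k <= expR k%:R * k`!%:R :> R.
Proof.
elim: k => [|k IH]; first by rewrite expr0 expR0 fact0 mulr1.
have step : k.+1%:R ^+ k <= expR 1 * k%:R ^+ k :> R.
  have [->|k0] := posnP k; first by rewrite !expr0 mulr1 -expR0 ler_expR.
  have kr0 : 0 < k%:R :> R by rewrite ltr0n.
  have : (1 + k%:R^-1) ^+ k <= expR (k%:R^-1) ^+ k :> R.
    by apply: lerXn2r; rewrite ?nnegrE ?expR_ge0 ?expR_ge1Dx// addr_ge0// invr_ge0.
  rewrite -expRM_natl mulfV ?gt_eqF// => h.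
  rewrite (_ : k.+1%:R = (1 + k%:R^-1) * k%:R); last first.
    by rewrite mulrDl mul1r mulVf ?gt_eqF// -natr1 addrC.
  by rewrite exprMn ler_wpM2r// exprn_ge0// ltW.
rewrite exprS factS natrM mulrCA ler_wpM2l//.
have -> : expR k.+1%:R = expR 1 * expR k%:R :> R by rewrite -expRD nat1r.
apply: le_trans step _.
by rewrite -mulrA ler_wpM2l// expR_ge0.
Qed.

Lemma card_wiring (R : realType) s k :
  (k%:R / expR 1) ^+ (s * s * k) <= #|wiring s k|%:R :> R.
Proof.
rewrite card_ffun card_Sn card_prod !card_ord natrX mulnC exprM.
apply: lerXn2r; rewrite ?nnegrE// ?exprn_ge0 ?divr_ge0 ?expR_ge0//.
rewrite expr_div_n ler_pdivrMr ?exprn_gt0 ?expR_gt0//.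
by rewrite -expRM_natl mulr1 mulrC expn_le_fact.
Qed.

(* Markov's inequality with weight k ^ agree w w', after enlarging the set of
   wirings to all functions from edges to 'I_k, where the sum factorises. *)
Lemma card_agree (R : realType) s k (w : wiring s k) : (0 < k)%N ->
  #|[set w' : wiring s k | (s * s * k <= 2 * agree w w')%N]%SET|%:R <=
  (2 * Num.sqrt k%:R) ^+ (s * s * k) :> R.
Proof.
move=> k0; set N := (s * s * k)%N; set r : R := Num.sqrt k%:R.
have r2 : r ^+ 2 = k%:R by rewrite sqr_sqrtr.
have r1 : 1 <= r by rewrite -sqrtr1 ler_sqrt// ler1n.
have r0 : 0 < r by exact: lt_le_trans r1.
pose g (e : edge s k) (y : 'I_k) : R := k%:R ^+ (w e.1 e.2 == y).
have g0 e y : 0 <= g e y by rewrite exprn_ge0.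
rewrite -(ler_pM2r (exprn_gt0 N r0)).
apply: (@le_trans _ _ (\sum_(w' : wiring s k) k%:R ^+ agree w w')).
  rewrite -sum1_card natr_sum mulr_suml [leLHS]big_mkcond/=.
  apply: ler_sum => w' _; rewrite inE mul1r; case: ifP => [Nw|_]; last by rewrite exprn_ge0.
  (* Agreement on half of the edges gives weight at least [k ^ (N / 2)], that is [r ^+ N]. *)
  by rewrite -r2 -exprM; apply: ler_weXn2l.
apply: (@le_trans _ _ (\sum_(h : {ffun edge s k -> 'I_k}) \prod_e g e (h e))).
  pose H (w' : wiring s k) : {ffun edge s k -> 'I_k} := [ffun e => w' e.1 e.2].
  have Hinj : injective H.
    move=> w1 w2 /ffunP w12; apply/ffunP => ut; apply/permP => l.
    by have := w12 (ut, l); rewrite !ffunE.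
  rewrite (eq_bigr (fun w' => \prod_e g e (H w' e))); last first.
    move=> w' _; rewrite /agree expr_sum; apply: eq_bigr => e _.
    by rewrite /g ffunE.
  rewrite -(big_imset (fun h : {ffun edge s k -> 'I_k} => \prod_e g e (h e)) (in2W Hinj))/=.
  rewrite big_mkcond/=; apply: ler_sum => h _; case: ifP => // _.
  by apply: prodr_ge0 => e _; exact: g0.
rewrite -(bigA_distr_bigA g)/= -exprMn.
have -> : (2 * r * r) ^+ N = \prod_(e : edge s k) (2 * r * r).
  by rewrite prodr_const !card_prod !card_ord.
apply: ler_prod => e _; rewrite sumr_ge0//=.
(* One edge has weight [k] at the agreeing value and 1 at the [k - 1] others, at most [2 k] in
   all. *)
rewrite (bigD1 (w e.1 e.2))//= /g eqxx expr1.
rewrite (eq_bigr (fun=> 1)) => [|y /negPf]; last by rewrite eq_sym => ->.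
rewrite sumr_const (_ : 2 * r * r = k%:R + k%:R); last first.
  by rewrite -mulrA -expr2 r2 mulr_natl mulr2n.
by rewrite lerD2l ler_nat -[leqRHS]card_ord max_card.
Qed.

Lemma card_agree_wiring (R : realType) s k (w : wiring s k) (g : R) :
  (0 < s)%N -> (0 < k)%N -> 0 <= g -> 8 * expR 1 * g <= Num.sqrt k%:R ->
  g ^+ (s * s * k) * #|[set w' : wiring s k | (s * s * k <= 2 * agree w w')%N]%SET|%:R <=
  4^-1 * #|wiring s k|%:R.
Proof.
move=> s0 k0 g0; set r : R := Num.sqrt k%:R; set N := (s * s * k)%N => gr.
have r2 : r ^+ 2 = k%:R by rewrite sqr_sqrtr.
have r0 : 0 < r by rewrite sqrtr_gt0 ltr0n.
have N0 : (0 < N)%N by rewrite !muln_gt0 s0.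
have e0 : 0 < expR 1 :> R := expR_gt0 _.
apply: le_trans (ler_wpM2l (exprn_ge0 _ g0) (card_agree R w k0)) _.
apply: le_trans (ler_wpM2l _ (card_wiring R s k)); last by rewrite invr_ge0.
rewrite -/N -/r -exprMn.
(* The hypothesis [gr] amounts to [2 g r <= r^2 / (4 e)]; afterwards [4^-1 ^+ N <= 4^-1] because [N]
   is positive. *)
apply: (@le_trans _ _ ((4^-1 * (k%:R / expR 1)) ^+ N)).
  apply: lerXn2r; rewrite ?nnegrE ?mulr_ge0 ?invr_ge0 ?divr_ge0 ?(ltW e0) ?(ltW r0)//.
  rewrite -r2 mulrA ler_pdivlMr//; nra.
rewrite exprMn ler_wpM2r ?exprn_ge0 ?divr_ge0 ?(ltW e0)//.
by rewrite -[leRHS]expr1; apply: ler_wiXn2l; rewrite ?invr_ge0 ?invf_le1 ?ler1n.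
Qed.

(** * Lower bound on the minimax risk *)

Lemma quad_form_delta2 (R : realType) p (M : 'M[R]_p) (j k : 'I_p) c :
  quad_form M (delta_mx 0 j + c *: delta_mx 0 k) =
  M j j + c * (M j k + M k j) + c ^+ 2 * M k k.
Proof.
rewrite /quad_form [(_ + _)^T]linearD/= [(_ *: _)^T]linearZ/= !trmx_delta.
rewrite !mulmxDl -!scalemxAl !mulmxDr -!scalemxAr -!rowE -!colE.
by rewrite !mxE; ring.
Qed.

(** The vectors [e_j - e_k] and [e_j + e_k] bound [M j k] by [(hi - lo) / 2], and the diagonal
    entries are at least [lo]. *)
Lemma corr_le (R : realType) p (M : 'M[R]_p) lo hi (j k : 'I_p) :
  M^T = M -> 0 < lo -> lemx lo%:M M -> lemx M hi%:M -> j != k ->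
  M j k / Num.sqrt (M j j * M k k) <= (hi - lo) / (2 * lo).
Proof.
move=> Ms lo0 loM Mhi jk.
have dif a c : quad_form (a%:M : 'M[R]_p) (delta_mx 0 j + c *: delta_mx 0 k) =
    a * (1 + c ^+ 2).
  have kj : k != j by rewrite eq_sym.
  rewrite quad_form_delta2 !mxE !eqxx (negPf jk) (negPf kj).
  by rewrite !mulr1n !mulr0n; ring.
have Mkj : M k j = M j k by rewrite -[in LHS]Ms mxE.
have Md i : lo <= M i i.
  have := loM (delta_mx 0 i + 0 *: delta_mx 0 i).
  by rewrite !quad_form_delta2 expr0n/= !mul0r !addr0 mxE eqxx mulr1n.
have Mjk : M j k <= (hi - lo) / 2.
  have := loM (delta_mx 0 j + -1 *: delta_mx 0 k).
  have := Mhi (delta_mx 0 j + 1 *: delta_mx 0 k).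
  by rewrite !dif !quad_form_delta2 Mkj; lra.
have lohi : 0 <= (hi - lo) / 2.
  have := loM (delta_mx 0 j + 1 *: delta_mx 0 k).
  have := Mhi (delta_mx 0 j + 1 *: delta_mx 0 k).
  by rewrite !dif; lra.
have sq0 : lo <= Num.sqrt (M j j * M k k).
  rewrite -[lo]ger0_norm ?(ltW lo0)// -sqrtr_sqr; apply: ler_wsqrtr.
  by rewrite expr2; apply: ler_pM => //; exact: ltW.
rewrite ler_pdivrMr ?(lt_le_trans lo0)//; apply: le_trans Mjk _.
set sq := Num.sqrt _ in sq0 *.
rewrite (_ : _ * sq = (hi - lo) / 2 * (sq / lo)); last by field; rewrite gt_eqF.
by rewrite ler_peMr// ler_pdivlMr// mul1r.
Qed.

(** [adjmx_quad_form] bounds the form of [A] by [a s] in absolute value; [a s <= 1/4] is what keeps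
    [1 - 2 A] above 1/2, as [mvnormal_chi2] requires. *)
Lemma adjmx_bounds (R : realType) p s k emb (a : R) (w : wiring s k) :
  injective emb -> 0 <= a -> 0 <= a * s%:R <= 4^-1 ->
  let A := @adjmx R p s k emb a w in
  [/\ lemx (1 - a * s%:R)%:M (1%:M - A), lemx (1%:M - A) (1 + a * s%:R)%:M &
      lemx (2^-1)%:M (1%:M - 2 *: A)].
Proof.
move=> emb_inj a0 /andP[as0 as4] A.
split=> x; have := adjmx_quad_form w x emb_inj a0; have := sqnorm_ge0 x;
  rewrite ler_norml -/A !(quad_formB, quad_formZ, quad_form_scalar) => x0 /andP[];
  nra.
Qed.

Lemma adjmx_mclass_gamma (R : realType) p s k emb (a gamma : R) (w : wiring s k) :
  (2 <= p)%N -> 1 < gamma -> injective emb -> 0 <= a ->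
  a * s%:R <= (1 - gamma^-1) / 4 ->
  mclass_gamma gamma (1%:M - @adjmx R p s k emb a w).
Proof.
move=> p2 g1 emb_inj a0 asg; set t := a * s%:R in asg.
have g0 : 0 < gamma by rewrite (lt_trans _ g1).
have gi0 : 0 < gamma^-1 by rewrite invr_gt0.
have t0 : 0 <= t by rewrite mulr_ge0.
have t4 : t <= 4^-1 by lra.
have [lo hi _] := adjmx_bounds w emb_inj a0 (introT andP (conj t0 t4)).
rewrite -/t in lo hi; set U := 1%:M - _ in lo hi *.
have lo0 : 0 < 1 - t by lra.
have hi0 : 0 < 1 + t by lra.
have Us : U^T = U by rewrite linearB/= trmx1 adjmx_sym.
have pU := lemx_posdef lo0 Us lo.
split; last 2 first.
- exact: posdefmx_unit.
- have Sl := lemx_inv_ge hi0 pU hi; have Sh := lemx_inv_le lo0 pU lo.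
  have Ss : (invmx U)^T = invmx U by rewrite trmx_inv Us.
  have hii0 : 0 < (1 + t)^-1 by rewrite invr_gt0.
  (* The left side is [t / (1 - t)], at most [4 t / 3] since [t <= 1/4]. *)
  have cle : ((1 - t)^-1 - (1 + t)^-1) / (2 * (1 + t)^-1) <= 1 - gamma^-1.
    rewrite (_ : _ / _ = t / (1 - t)); last by field; rewrite !gt_eqF.
    by rewrite ler_pdivrMr//; nra.
  rewrite /gamma_corr; set S := [set r | _].
  have supS : sup S <= 1 - gamma^-1.
    apply: ge_sup => [|_ [i [j [ij ->]]]].
      (* The set of correlations is nonempty because [2 <= p]; the bound on its [sup] needs this. *)
      pose i0 := Ordinal (ltnW p2); pose i1 := Ordinal p2.
      by exists (invmx U i0 i1 / Num.sqrt (invmx U i0 i0 * invmx U i1 i1)), i0, i1.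
    by apply: le_trans cle; exact: corr_le.
  by rewrite -[leRHS]invrK lef_pV2 ?posrE//; lra.
split; first by split=> // x; exact: posdefmx_quad_ge0.
by move=> i j ij; rewrite !mxE (negPf ij) mulr0n sub0r oppr_le0 adjmx_ge0.
Qed.

(** * From the count of good hypotheses to the risk *)

Lemma stein_ssymE (R : realType) p (T U : 'M[R]_p) : (0 < p)%N ->
  mxdot (T - U) (invmx U - invmx T) = 2 * p%:R * stein_ssym T U.
Proof.
by move=> p0; rewrite /stein_ssym mulrA divff ?mul1r// gt_eqF// mulr_gt0// ltr0n.
Qed.

Lemma measurable_sublevel d (T : measurableType d) (R : realType) (f : T -> R)
    (t : R) :
  measurable_fun setT f -> measurable [set x | f x < t].
Proof.
move=> mf; have := mf measurableT _ (measurable_itv `]-oo, t[).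
by rewrite setTI (_ : _ @^-1` _ = [set x | f x < t]).
Qed.

Lemma markov_half d (T : measurableType d) (R : realType) (P : probability T R)
    (f : T -> R) (t : R) :
  0 <= t -> (forall x, 0 <= f x) -> measurable_fun setT f ->
  (P [set x | (f x < t)%R] <= (2^-1)%:E)%E -> ((t / 2)%:E <= 'E_P[f])%E.
Proof.
move=> t0 f0 mf Pf; rewrite unlock.
have mB : measurable [set x | f x < t] by exact: measurable_sublevel.
set B := [set x | _] in Pf mB.
have mfE : measurable_fun setT (EFin \o f) by exact/measurable_EFinP.
apply: (@le_trans _ _ (\int[P]_(x in ~` B) (f x)%:E)%E); last first.
  by apply: ge0_subset_integral => //; [exact: measurableC|move=> x _; rewrite lee_fin].
apply: (@le_trans _ _ (\int[P]_(x in ~` B) t%:E)%E); last first.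
  apply: ge0_le_integral => //; first exact: measurableC.
  - exact: measurable_funTS.
  - by move=> x; rewrite /B/= lee_fin => /negP; rewrite -leNgt.
rewrite integral_cst//; last exact: measurableC.
rewrite [X in (_ <= _ * X)%E](probability_setC P mB) EFinM.
apply: lee_wpmul2l; first by rewrite lee_fin.
have PB : P B \is a fin_num by exact: fin_num_measure.
by move: Pf; rewrite -(fineK PB) -EFinB !lee_fin; lra.
Qed.

(** The graph parameters stay free here. With [g = expR (n%:R * (2 * a ^+ 2))] the second moment of
    the likelihood ratio is at most [g ^+ N], and the last hypothesis makes the count of wirings
    beat this factor. *)
Lemma minimax_risk_wiring (R : realType) (n p s k : nat) (gamma a : R) :
  (0 < s)%N -> (0 < k)%N -> (2 * (s * k) <= p)%N -> (2 <= p)%N -> 1 < gamma ->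
  0 < a -> a * s%:R <= (1 - gamma^-1) / 4 ->
  8 * expR 1 * expR (n%:R * (2 * a ^+ 2)) <= Num.sqrt k%:R ->
  ((a ^+ 2 * (s * s * k)%:R / (64 * p%:R))%:E <= minimax_risk n p gamma)%E.
Proof.
move=> s0 k0 skp p2 g1 a0 asg kbig; set N := (s * s * k)%N.
have p0 : (0 < p)%N by exact: ltnW.
have pr0 : 0 < p%:R :> R by rewrite ltr0n.
have [emb emb_inj] : exists emb : node s k -> 'I_p, injective emb.
  have cardp : (#|{: node s k}| <= p)%N.
    by rewrite card_sum !card_prod !card_ord addnn -mul2n.
  exists (fun z => widen_ord cardp (enum_rank z)) => y z /(congr1 val) /= yz.
  exact/enum_rank_inj/val_inj.
pose U w : 'M[R]_p := 1%:M - adjmx emb a w.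
have as4 : 0 <= a * s%:R <= 4^-1.
  rewrite mulr_ge0 ?(ltW a0)//=; apply: le_trans asg _.
  have : 0 < gamma^-1 by rewrite invr_gt0 (lt_trans _ g1).
  lra.
have Us w : (U w)^T = U w by rewrite linearB/= trmx1 adjmx_sym.
have Ul w : lemx (2^-1)%:M (U w).
  have [lo _ _] := adjmx_bounds w emb_inj (ltW a0) as4.
  move=> x; apply: le_trans (lo x); rewrite !quad_form_scalar.
  by apply: (ler_wpM2r (sqnorm_ge0 x)); move/andP: as4 => []; lra.
have Uh w : lemx (U w) 2%:M.
  have [_ hi _] := adjmx_bounds w emb_inj (ltW a0) as4.
  move=> x; apply: le_trans (hi x) _; rewrite !quad_form_scalar.
  by apply: (ler_wpM2r (sqnorm_ge0 x)); move/andP: as4 => []; lra.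
(* The quasi-triangle inequality with both hypotheses equal gives nonnegativity. *)
have stein0 T w : posdefmx T -> 0 <= stein_ssym T (U w).
  move=> pT; have := stein_quasi_triangle pT (Us w) (Us w) (Ul w) (Ul w) (Uh w) (Uh w).
  rewrite subrr /mxdot mulmx0 linear0 mul0r -/(mxdot _ _) stein_ssymE//.
  by rewrite -mulrDl pmulr_rge0// addr_gt0// mulr_gt0.
rewrite /minimax_risk; apply: le_ereal_inf_tmp => /= _ [T [mT pT] <-].
(* Two losses below [t] give pairings of total below [4 p t = a^2 N / 8], while the quasi-triangle
   inequality bounds this total below by [a^2 (N - agree) / 4]; hence the wirings agree on more than
   [N / 2] edges. *)
pose t := a ^+ 2 * N%:R / (32 * p%:R).
have t0 : 0 <= t by rewrite divr_ge0// mulr_ge0// sqr_ge0.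
pose C w := [set X | stein_ssym (T X) (U w) < t].
have mL w : measurable_fun setT (fun X => stein_ssym (T X) (U w)).
  exact: measurable_stein_ssym.
have mC w : measurable (C w) by exact: measurable_sublevel.
have close w w' X : C w X -> C w' X -> (N <= 2 * agree w' w)%N.
  rewrite /C/= => Cw Cw'.
  have := stein_quasi_triangle (pT X) (Us w) (Us w') (Ul w) (Ul w') (Uh w) (Uh w').
  have -> : U w - U w' = adjmx emb a w' - adjmx emb a w.
    by rewrite /U opprB addrC addrA subrK.
  rewrite mxdot_adjmxB// !stein_ssymE// -/N => qt.
  have : 2 * p%:R * stein_ssym (T X) (U w) + 2 * p%:R * stein_ssym (T X) (U w') <
      a ^+ 2 * N%:R / 8.
    have -> : a ^+ 2 * N%:R / 8 = 2 * p%:R * t + 2 * p%:R * t.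
      by rewrite /t; field; rewrite gt_eqF.
    by apply: ltrD; rewrite ltr_pM2l// mulr_gt0.
  move=> /(le_lt_trans qt) {}qt.
  rewrite -(ler_nat R) natrM ltW// -subr_gt0 -(pmulr_rgt0 _ (exprn_gt0 2 a0)).
  lra.
have F0 : (0 < #|{: wiring s k}|)%N.
  by apply/card_gt0P; exists [ffun=> 1%g].
pose ball w0 := #|[set w' : wiring s k | (N <= 2 * agree w0 w')%N]%SET|.
have [w1 ballw1] := bigop.eq_bigmax ball F0.
(* All wirings for which [T X] is good lie in the ball around any one of them, hence number at most
   the size of the largest ball. *)
have Cb X : (#|[set w | `[< C w X >]]%SET| <= ball w1)%N.
  have [->|[w0]] := set_0Vmem [set w | `[< C w X >]]%SET; first by rewrite cards0.
  rewrite !inE => Cw0; rewrite -ballw1.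
  apply: leq_trans (leq_bigmax w0); apply: subset_leq_card.
  by apply/fintype.subsetP => w; rewrite !inE => Cw; exact: (@close w w0 X).
(* The reference law does not depend on the wiring, so the averaging argument applies to it. *)
pose Q := iid_rows (mvnormal_prob (1%:M : 'M[R]_p)) n.
have [w Qw] := exists_le_average Q F0 mC Cb.
apply: le_ereal_sup_tmp; exists (risk T (U w)).
  by exists (U w) => //; apply: adjmx_mclass_gamma => //; exact: ltW.
rewrite (_ : _ / _ = t / 2); last by rewrite /t; field; rewrite gt_eqF.
apply: markov_half => //; first by move=> X; exact: stein0.
have [_ _ Wl] := adjmx_bounds w emb_inj (ltW a0) as4.
pose g := expR (n%:R * (2 * a ^+ 2)).
have g0 : 0 < g by exact: expR_gt0.
have gN0 : 0 < g ^+ N by rewrite exprn_gt0.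
(* With this weight the second-moment term is exactly 1/4 and the other is [g ^+ N] times the
   probability under [Q], also at most 1/4. *)
have lam0 : 0 < (2 * g ^+ N)^-1 by rewrite invr_gt0 mulr_gt0.
apply: le_trans (mvnormal_chi2 (adjmx_sym emb a w) Wl (mC w) lam0) _.
rewrite mxdot_adjmx// agreexx -/N mulrA expRM_natr -/g.
have ballN := card_agree_wiring w1 s0 k0 (ltW g0) kbig.
rewrite -/N -/(ball w1) in ballN.
apply: (@le_trans _ _ ((4^-1)%:E + (g ^+ N)%:E *
    ((ball w1)%:R / #|{: wiring s k}|%:R)%:E)%E).
  apply: leeD.
    rewrite lee_fin (_ : _ * _ = 4^-1)//; field.
    by rewrite gt_eqF.
  rewrite invrK (_ : 2 * g ^+ N / 2 = g ^+ N); last by field.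
  by apply: lee_wpmul2l => //; rewrite lee_fin ltW.
rewrite -EFinM -EFinD lee_fin mulrA.
have : g ^+ N * (ball w1)%:R / #|{: wiring s k}|%:R <= 4^-1.
  by rewrite ler_pdivrMr// ltr0n.
lra.
Qed.

(** * Choice of the parameters *)

(** From [expR (- 1/2) >= 1/2], inverted and squared. *)
Lemma expR1_le4 (R : realType) : expR 1 <= 4 :> R.
Proof.
have h := expR_ge1Dx (- 2^-1 : R).
have e0 := expR_gt0 (2^-1 : R).
have : expR (2^-1 : R) * expR (- 2^-1) = 1 by rewrite -expRD subrr expR0.
have : expR 1 = expR (2^-1 : R) ^+ 2.
  by rewrite -expRM_natl; congr expR; rewrite mulfV.
by move=> -> ee; nra.
Qed.

Theorem theorem2 (R : realType) :
  exists c1 c2 beta : R, [/\ 0 < c1, 0 < c2, 1 < beta &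
    forall gamma : R, 1 < gamma ->
    exists cgamma : R, 0 < cgamma /\
    forall n p : nat, (0 < n)%N -> (2 <= p)%N ->
      c1 * n%:R `^ beta <= p%:R -> p%:R <= expR (c2 * n%:R) ->
      ((cgamma * Num.sqrt (ln p%:R / n%:R))%:E <= minimax_risk n p gamma)%E].
Proof.
(* [p >= 8^8 n^2] yields [p^(1/2) >= 8^4 n], whose constant is used up in [kbig]; [p <= expR n]
   yields [ln p <= n], so that [s] below is positive. *)
exists (8 ^+ 8), 1, 2; split; [by rewrite exprn_gt0|by []|by rewrite ltr1n|].
move=> gamma g1; pose d := (1 - gamma^-1) / 4.
have gi1 : gamma^-1 < 1 by rewrite invf_lt1// (lt_trans _ g1).
have gi0 : 0 < gamma^-1 by rewrite invr_gt0 (lt_trans _ g1).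
have d0 : 0 < d by rewrite /d; lra.
have d4 : d <= 4^-1 by rewrite /d; lra.
exists (d ^+ 2 / 512); split; first by rewrite divr_gt0 ?exprn_gt0 ?ltr0n.
move=> n p n0 p2; rewrite powR_mulrn// mul1r => np pn.
have nr1 : 1 <= n%:R :> R by rewrite ler1n.
have pr0 : 0 < p%:R :> R by rewrite ltr0n ltnW.
set L := ln p%:R.
have LE : expR L = p%:R by rewrite lnK// posrE.
(* All size estimates become polynomial in [y], the eighth root of [p]. *)
pose y := expR (L / 8).
have y0 : 0 < y by exact: expR_gt0.
have y8 : y ^+ 8 = p%:R by rewrite -expRM_natl mulrC divfK.
have ny : n%:R * 8 ^+ 4 <= y ^+ 4.
  rewrite -ler_sqr ?nnegrE ?mulr_ge0 ?exprn_ge0 ?(ltW y0)//.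
  by rewrite exprMn -!exprM y8 mulrC.
have y8le : 8 <= y.
  rewrite -(@ler_pXn2r _ 4) ?nnegrE ?(ltW y0)//.
  by apply: le_trans ny; rewrite ler_peMl// exprn_ge0.
have L1 : 1 <= L.
  rewrite -ler_expR LE -y8; apply: le_trans (expR1_le4 R) _.
  apply: (@le_trans _ _ y); first by lra.
  by rewrite -[leLHS]expr1; apply: ler_weXn2l => //; lra.
have Ln : L <= n%:R by rewrite -ler_expR LE.
have L0 : 0 < L by lra.
(* The target rate is [q^-1]; [s] is the integer part of [q], and [q >= 1] gives
   [q / 2 <= s <= q]. *)
pose q : R := Num.sqrt (n%:R / L).
have q1 : 1 <= q by rewrite -[1]sqrtr1; apply: ler_wsqrtr; rewrite ler_pdivlMr// mul1r.
have q0 : 0 < q by lra.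
have q2 : q ^+ 2 = n%:R / L by rewrite sqr_sqrtr// divr_ge0// ltW.
have qV : Num.sqrt (L / n%:R) = q^-1.
  by rewrite -[L / _]invf_div sqrtrV// divr_ge0// ltW.
pose s := Num.trunc q.
have /andP[sq qs] : s%:R <= q < s.+1%:R by apply: truncn_itv; exact: ltW.
have s0 : (0 < s)%N.
  by rewrite -ltnS -(ltr_nat R); apply: le_lt_trans qs.
have sr1 : 1 <= s%:R :> R by rewrite ler1n.
have qs2 : q <= 2 * s%:R by move: qs; rewrite -natr1; lra.
have sy : s%:R <= y ^+ 2.
  rewrite -ler_sqr ?nnegrE ?exprn_ge0 ?(ltW y0)//.
  apply: (@le_trans _ _ (q ^+ 2)).
    by rewrite ler_sqr ?nnegrE// ltW.
  rewrite q2 -exprM ler_pdivrMr//; apply: le_trans (_ : y ^+ 4 <= _).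
    by apply: le_trans ny; rewrite ler_peMr// -natrX ler1n.
  by rewrite ler_peMr// exprn_ge0 ?ltW.
pose k := (p %/ (2 * s))%N.
have s2 : (0 < 2 * s)%N by rewrite muln_gt0.
have skp : (2 * (s * k) <= p)%N by rewrite mulnA mulnC; exact: leq_divM.
have k0 : (0 < k)%N.
  rewrite divn_gt0// -(ler_nat R) natrM -y8.
  have := sy; have : y ^+ 8 = y ^+ 2 * y ^+ 6 by rewrite -exprD.
  have y6 : 2 <= y ^+ 6.
    apply: (@le_trans _ _ y); first by lra.
    by rewrite -[leLHS]expr1; apply: ler_weXn2l => //; lra.
  have y20 : 0 <= y ^+ 2 by rewrite exprn_ge0// ltW.
  by move=> ->; nra.
have kr1 : 1 <= k%:R :> R by rewrite ler1n.
(* [p < 2 s (k + 1)] and [1 <= k], so rounding in [k] loses at most a factor 2. *)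
have pk : p%:R <= 4 * (s%:R * k%:R) :> R.
  have := ltn_ceil p s2; rewrite -/k -(ltr_nat R) natrM -natr1 natrM.
  have : s%:R * 1 <= s%:R * k%:R :> R by rewrite ler_wpM2l.
  lra.
have ky : y ^+ 6 / 4 <= k%:R.
  rewrite ler_pdivrMr// -(ler_pM2l (exprn_gt0 2 y0)) -exprD y8.
  apply: le_trans pk _.
  have := ler_wpM2r (ltW (lt_le_trans ltr01 kr1)) sy; lra.
(* This makes [a s <= d], while [2 n a^2 = 2 d^2 ln p] is at most [ln p / 8] because [d <= 1/4];
   thus the factor [g] per edge is at most [y]. *)
pose a := d / q.
have a0 : 0 < a by rewrite divr_gt0.
have asd : a * s%:R <= d by rewrite /a mulrAC ler_pdivrMr// ler_pM2l.
have na : n%:R * (2 * a ^+ 2) <= L / 8.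
  rewrite (_ : _ * _ = 2 * d ^+ 2 * L).
    have : d ^+ 2 <= 4^-1 ^+ 2 by rewrite ler_sqr ?nnegrE ?invr_ge0 ?(ltW d0).
    rewrite expr2; nra.
  rewrite /a expr_div_n q2; field; rewrite !gt_eqF//; lra.
(* As [e <= 4], it suffices that [32 y <= sqrt k]. Since [k >= y^6 / 4], this follows from
   [y^4 >= 8^4]. *)
have kbig : 8 * expR 1 * expR (n%:R * (2 * a ^+ 2)) <= Num.sqrt k%:R.
  have gy : expR (n%:R * (2 * a ^+ 2)) <= y by rewrite ler_expR.
  apply: (@le_trans _ _ (32 * y)).
    have := expR1_le4 R; have := expR_gt0 (n%:R * (2 * a ^+ 2)).
    have := expR_gt0 (1 : R); nra.
  rewrite -[32 * y]ger0_norm ?mulr_ge0 ?(ltW y0)// -sqrtr_sqr.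
  apply: ler_wsqrtr; apply: le_trans ky.
  have : y ^+ 6 = y ^+ 4 * y ^+ 2 by rewrite -exprD.
  have y4 : 8 ^+ 4 <= y ^+ 4 by apply: le_trans ny; rewrite ler_peMl// exprn_ge0.
  have e84 : 8 ^+ 4 = 4096 :> R by rewrite -natrX.
  have y20 : 0 <= y ^+ 2 by rewrite exprn_ge0// ltW.
  rewrite exprMn e84 in y4 *; move=> ->; nra.
apply: (le_trans _ (@minimax_risk_wiring R n p s k gamma a s0 k0 skp p2 g1 a0 asd kbig)).
rewrite lee_fin qV ler_pdivlMr ?mulr_gt0 ?ltr0n ?(ltnW p2)//.
rewrite (expr_div_n d q 2 : a ^+ 2 = _) !natrM.
(* By [pk] the bound is at least [a^2 s / 256], and [s >= q / 2] turns this into [d^2 / (512 q)]. *)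
apply: (@le_trans _ _ (d ^+ 2 / 512 / q * (64 * (4 * (s%:R * k%:R))))).
  apply: ler_wpM2l; last by apply: ler_wpM2l => //; rewrite ler0n.
  by rewrite !divr_ge0 ?exprn_ge0 ?ler0n ?(ltW d0) ?(ltW q0).
rewrite (_ : _ * _ = d ^+ 2 / q ^+ 2 * (q / 2) * (s%:R * k%:R)); last first.
  by field; rewrite gt_eqF.
have sk0 : 0 <= s%:R * k%:R :> R by rewrite mulr_ge0.
rewrite -mulrA; apply: ler_wpM2l.
  by rewrite divr_ge0 ?exprn_ge0 ?(ltW d0) ?(ltW q0).
by rewrite -mulrA; apply: ler_wpM2r => //; lra.
Qed.
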